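(* Let $s$ be a positive integer and let $\Omega_\mu(y_1,\dots,y_s)$ be an identically non-vanishing function of $s$ complex variables $y_1,\dots,y_s$ and of complex order $\mu$. Let $\mu,\psi\in\mathbb{C}$, let $a_l\ne0$ ($l=0,1,2,\dots$) be coefficients, and set $$\Lambda_{\mu,\psi}(y_1,\dots,y_s;\zeta):=\sum_{l=0}^{\infty}a_l\,\Omega_{\mu+\psi l}(y_1,\dots,y_s)\,\zeta^l .$$ For $p\in\mathbb{N}$ and $n\in\mathbb{N}_0$ set $$\Theta_{n,p}^{\mu,\psi}(x_1,\dots,x_r;y_1,\dots,y_s;\xi):=\sum_{l=0}^{[n/p]}a_l\,(\lambda)_{n-pl}\,{}^{(k)}E^{(r)}\left(-(n-pl),\beta_{k+1},\dots,\beta_r;\gamma_1,\dots,\gamma_r;x_1,\dots,x_r\right)\Omega_{\mu+\psi l}(y_1,\dots,y_s)\frac{\xi^l}{(n-pl)!}.$$ Then, for every $p\in\mathbb{N}$, $$\sum_{n=0}^{\infty}\Theta_{n,p}^{\mu,\psi}\left(x_1,\dots,x_r;y_1,\dots,y_s;\frac{\eta}{t^p}\right)t^n$$ $$=\Lambda_{\mu,\psi}(y_1,\dots,y_s;\eta)\,(1-t)^{-\lambda}\,{}^{(k)}E^{(r)}\left(\lambda,\beta_{k+1},\dots,\beta_r;\gamma_1,\dots,\gamma_r;\frac{x_1(-t)^{\rho}}{(1-t)^{\rho}},\dots,\frac{x_k(-t)^{\rho}}{(1-t)^{\rho}},\frac{-x_{k+1}t}{1-t},\dots,\frac{-x_rt}{1-t}\right),$$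 provided that each member of this identity exists.
   Context: $\mathbb{N}=\{1,2,\dots\}$, $\mathbb{N}_0=\mathbb{N}\cup\{0\}$, and $[\cdot]$ is the integer part. The Pochhammer symbol is $(\lambda)_\nu=\Gamma(\lambda+\nu)/\Gamma(\lambda)$ for $\lambda\in\mathbb{C}\setminus\{0,-1,-2,\dots\}$; moreover $(\lambda)_0=1$ and $(\lambda)_n=\lambda(\lambda+1)\cdots(\lambda+n-1)$ for every positive integer $n$ and every $\lambda\in\mathbb{C}$. (In particular, a symbol $(-n)_\nu$ with $n$ a nonnegative integer is defined only for nonnegative integers $\nu$.) Let $r\ge 1$ and $0\le k\le r$ be integers and $\rho\ge 0$. The multivariable hypergeometric function ${}^{(k)}E^{(r)}$ (depending on $\rho$) with complex parameters $\alpha,\beta_{k+1},\dots,\beta_r,\gamma_1,\dots,\gamma_r$ and complex variables $x_1,\dots,x_r$ is $${}^{(k)}E^{(r)}(\alpha,\beta_{k+1},\dots,\beta_r;\gamma_1,\dots,\gamma_r;x_1,\dots,x_r):=\sum_{m_1,\dots,m_r=0}^{\infty}(\alpha)_{\rho(m_1+\dots+m_k)+m_{k+1}+\dots+m_r}\frac{(\beta_{k+1})_{m_{k+1}}\cdots(\beta_r)_{m_r}}{(\gamma_1)_{m_1}\cdots(\gamma_r)_{m_r}}\frac{x_1^{m_1}}{m_1!}\cdots\frac{x_r^{m_r}}{m_r!},$$ where $\rho(\sqrt{|x_1|}+\dots+\sqrt{|x_k|})+|x_{k+1}|+\dots+|x_r|<1$. Here $\lambda\in\mathbb{C}$ and $|t|<1$,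 and powers of $1-t$ are principal. *)

(* Defs.v *)
From HB Require Import structures.
From mathcomp Require Import all_boot all_order all_algebra finmap complex.
From mathcomp Require Import all_classical all_reals all_analysis.
From mathcomp.analysis.showcase Require Import summability.

Set Implicit Arguments.
Unset Strict Implicit.
Unset Printing Implicit Defensive.

Import Order.TTheory GRing.Theory Num.Theory.
Import numFieldNormedType.Exports.

Local Open Scope classical_set_scope.
Local Open Scope ring_scope.
Local Open Scope complex_scope.

(* Limits of complex numbers are taken in R[i]^o, which carries the topology
   of the modulus; R[i] itself has no canonical topology. *)

Definition cexp {R : realType} (z : R[i]) : R[i] :=
  (expR (complex.Re z) * cos (complex.Im z)) +i* (expR (complex.Re z) * sin (complex.Im z)).

(* Principal argument, with values in ]-pi, pi] for z != 0. *)
Definition carg {R : realType} (z : R[i]) : R :=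
  let theta := acos (complex.Re z / ComplexField.Normc.normc z) in
  if 0 <= complex.Im z then theta else - theta.

Definition clog {R : realType} (z : R[i]) : R[i] :=
  ln (ComplexField.Normc.normc z) +i* carg z.

(* Principal power z^w; the convention at z = 0 is that of powR. *)
Definition cpow {R : realType} (z w : R[i]) : R[i] :=
  if z == 0 then (w == 0)%:R else cexp (w * clog z).

(* Gauss's limit formula; a junk value at the poles 0, -1, -2, ... *)
Definition cGamma {R : realType} (z : R[i]) : R[i] :=
  limn (fun n : nat =>
    (n`!%:R * cpow n%:R z / \prod_(i < n.+1) (z + i%:R)) : R[i]^o).

Definition nonpos_int {R : realType} (z : R[i]) : Prop :=
  exists n : nat, z = - n%:R.

Definition pochn {R : realType} (z : R[i]) (n : nat) : R[i] :=
  \prod_(i < n) (z + i%:R).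

(* (z)_nu, as a partial operation: for natural nu it is the finite product,
   for every z; otherwise it is the Gamma quotient, which requires that
   neither z nor z + nu be a pole of Gamma. *)
Definition poch_defined {R : realType} (z : R[i]) (nu : R) : Prop :=
  nu \is a Num.nat \/ (~ nonpos_int z /\ ~ nonpos_int (z + nu%:C)).

Definition poch {R : realType} (z : R[i]) (nu : R) : R[i] :=
  if nu \is a Num.nat then pochn z (Num.truncn nu)
  else cGamma (z + nu%:C) / cGamma z.

(* Indices run over 0, ..., r - 1: the first group of variables x_1, ..., x_k
   is x i with i < k.  Of the family be, only the entries be i with k <= i
   are used. *)

Definition E_index {R : realType} (rho : R) (r k : nat)
    (m : {ffun 'I_r -> nat}) : R :=
  rho * (\sum_(i < r | (i < k)%N) m i)%:R
  + (\sum_(i < r | (k <= i)%N) m i)%:R.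

Definition E_term {R : realType} (rho : R) (r k : nat) (al : R[i])
    (be ga x : 'I_r -> R[i]) (m : {ffun 'I_r -> nat}) : R[i] :=
  poch al (E_index rho k m)
  * ((\prod_(i < r | (k <= i)%N) pochn (be i) (m i))
     / (\prod_(i < r) pochn (ga i) (m i)))
  * \prod_(i < r) (x i ^+ m i / (m i)`!%:R).

Definition E_domain {R : realType} (rho : R) (r k : nat)
    (x : 'I_r -> R[i]) : Prop :=
  rho * (\sum_(i < r | (i < k)%N)
           Num.sqrt (ComplexField.Normc.normc (x i)))
  + \sum_(i < r | (k <= i)%N) ComplexField.Normc.normc (x i) < 1.

(* The multiple series is summed along the net of finite sets of
   multi-indices, i.e. unconditionally (equivalently, absolutely). *)
Definition E_exists {R : realType} (rho : R) (r k : nat) (al : R[i])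
    (be ga x : 'I_r -> R[i]) : Prop :=
  [/\ E_domain rho k x,
      forall m : {ffun 'I_r -> nat}, poch_defined al (E_index rho k m),
      forall i : 'I_r, ~ nonpos_int (ga i)
    & cvg (partial_sum (E_term rho k al be ga x : _ -> R[i]^o) @ totally)].

Definition E {R : realType} (rho : R) (r k : nat) (al : R[i])
    (be ga x : 'I_r -> R[i]) : R[i] :=
  summability.sum (E_term rho k al be ga x : _ -> R[i]^o).

Definition Lambda_term {R : realType} (s : nat) (a : nat -> R[i])
    (Omega : R[i] -> ('I_s -> R[i]) -> R[i]) (mu psi : R[i])
    (y : 'I_s -> R[i]) (zeta : R[i]) (l : nat) : R[i]^o :=
  a l * Omega (mu + psi * l%:R) y * zeta ^+ l.

Definition Lambda_exists {R : realType} (s : nat) (a : nat -> R[i])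
    (Omega : R[i] -> ('I_s -> R[i]) -> R[i]) (mu psi : R[i])
    (y : 'I_s -> R[i]) (zeta : R[i]) : Prop :=
  cvgn (series (Lambda_term a Omega mu psi y zeta)).

Definition Lambda {R : realType} (s : nat) (a : nat -> R[i])
    (Omega : R[i] -> ('I_s -> R[i]) -> R[i]) (mu psi : R[i])
    (y : 'I_s -> R[i]) (zeta : R[i]) : R[i] :=
  limn (series (Lambda_term a Omega mu psi y zeta)).

Definition Theta_exists {R : realType} (rho : R) (r k : nat)
    (be ga x : 'I_r -> R[i]) (n p : nat) : Prop :=
  forall l : nat, (l <= n %/ p)%N ->
    E_exists rho k (- (n - p * l)%:R) be ga x.

Definition Theta {R : realType} (rho : R) (r k s : nat) (lambda : R[i])
    (be ga : 'I_r -> R[i]) (a : nat -> R[i])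
    (Omega : R[i] -> ('I_s -> R[i]) -> R[i]) (mu psi : R[i]) (n p : nat)
    (x : 'I_r -> R[i]) (y : 'I_s -> R[i]) (xi : R[i]) : R[i] :=
  \sum_(l < (n %/ p).+1)
    a l * pochn lambda (n - p * l) * E rho k (- (n - p * l)%:R) be ga x
    * Omega (mu + psi * l%:R) y * (xi ^+ l / (n - p * l)`!%:R).

Definition E_arg {R : realType} (rho : R) (r k : nat) (t : R[i])
    (x : 'I_r -> R[i]) : 'I_r -> R[i] :=
  fun i => if (i < k)%N
           then x i * cpow (- t) rho%:C / cpow (1 - t) rho%:C
           else - x i * t / (1 - t).

(* Main.v *)
Require Import Defs.
From HB Require Import structures.
From mathcomp Require Import all_boot all_order all_algebra finmap complex.
From mathcomp Require Import all_classical all_reals all_analysis.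
From mathcomp.analysis.showcase Require Import summability.
From mathcomp Require Import ring lra.

Set Implicit Arguments.
Unset Strict Implicit.
Unset Printing Implicit Defensive.

Import Order.TTheory GRing.Theory Num.Theory.
Import numFieldNormedType.Exports.

Local Open Scope classical_set_scope.
Local Open Scope ring_scope.
Local Open Scope complex_scope.
Local Notation modc := ComplexField.Normc.normc.

(** Both members are values at z = 1 of functions of an auxiliary variable z.

    Collecting the multiple series by the index d of its Pochhammer symbol gives
    E(al; x) = sum_d (al)_d Q_d, where Q_d depends neither on al nor on the
    dilation of the arguments.  Put e_d = (lambda)_d Q_d, G(w) = sum_d e_d w^d and
    w(z) = - t z / (1 - t z).  The E of the right-hand member is G(w(1))
    ([E_term_arg], [group_by_index]).  Since (-N)_d / N! = (-1)^d / (N - d)!, the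
    terminating values satisfy
    (lambda)_N E(-N; x) t^N / N! =
      sum_(d <= N) e_d (-t)^d (lambda + d)_(N-d) t^(N-d) / (N - d)!
    ([euler_coef_E]), and this number b_N is the coefficient of z^N in
    B(z) = sum_d e_d (- t z)^d (1 - t z)^(- lambda - d)
         = (1 - t z)^(- lambda) G(w(z)).
    With A_l = a_l Omega_(mu + psi l)(y) eta^l, the n-th term of the left-hand
    member is c_n = sum_(p l <= n) A_l b_(n - p l), the coefficient of z^n in
    A(z^p) B(z).  So the claim reads C(1) = A(1) B(1), with C(z) = sum_n c_n z^n.

    No rearrangement of the series at z = 1 is available: C and A need only converge
    conditionally there, sum_N b_N may diverge, and the double series of B need
    not converge absolutely, as |t| / (1 - |t|) can exceed |w(1)|.  The proof
    therefore goes through the interior: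
    - for |z| <= 1/3 everything converges absolutely and C(z) = A(z^p) B(z)
      ([lacunary_series]);
    - for 0 <= x < 1 one has |w(x)| < |w(1)| with a quantitative margin
      ([moebius_gap]), because 1/x is farther from t than 1 is; hence both
      sides have Taylor expansions at all points of [0, x], on discs of one
      common radius, and the identity propagates from disc to disc up to x
      ([taylor_continuation], [lacunary_series_unit_interval]);
    - as x tends to 1 from below, C and A converge by Abel's theorem
      ([abel_limit]) and B by absolute convergence ([pser_continuous]);
      this is [lacunary_sum].

    The factor (1 - t)^(- lambda) enters through the binomial series.  It is the
    exponential of lambda times the series L of - log(1 - t)
    ([binser_cexp]), and - L is the principal logarithm of 1 - t because its
    imaginary part stays between - pi/2 and pi/2 ([Im_logser]). *)

(** * The modulus of a complex number as a real number *)

Section Modulus.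
Variable R : realType.
Implicit Types (z w : R[i]) (r : R).

Lemma norm_modc z : `|z| = (modc z)%:C.
Proof. by []. Qed.

Lemma modc_ge0 z : 0 <= modc z.
Proof. by case: z => x y; rewrite /= sqrtr_ge0. Qed.

Lemma modcM z w : modc (z * w) = modc z * modc w.
Proof. exact: ComplexField.Normc.normcM. Qed.

Lemma modcV z : modc z^-1 = (modc z)^-1.
Proof. exact: ComplexField.Normc.normcV. Qed.

Lemma modcf z w : modc (z / w) = modc z / modc w.
Proof. by rewrite modcM modcV. Qed.

Lemma modcN z : modc (- z) = modc z.
Proof. exact: normcN. Qed.

Lemma modcD z w : modc (z + w) <= modc z + modc w.
Proof. exact: le_normcD. Qed.

Lemma modcB z w : modc (z - w) <= modc z + modc w.
Proof. by rewrite (le_trans (modcD _ _)) ?modcN. Qed.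

Lemma modc_subC z w : modc (z - w) = modc (w - z).
Proof. by rewrite -modcN opprB. Qed.

Lemma modc_subr_ge z w : modc z - modc w <= modc (z - w).
Proof. by have := modcD (z - w) w; rewrite subrK; lra. Qed.

Lemma modc0 : modc (0 : R[i]) = 0.
Proof. exact: ComplexField.Normc.normc0. Qed.

Lemma modc1 : modc (1 : R[i]) = 1.
Proof. exact: ComplexField.Normc.normc1. Qed.

Lemma modcX z n : modc (z ^+ n) = modc z ^+ n.
Proof. by elim: n => [|n IH]; rewrite ?expr0 ?modc1 // !exprS modcM IH. Qed.

Lemma modc_real r : modc r%:C = `|r|.
Proof. by rewrite /= expr0n addr0 sqrtr_sqr. Qed.

Lemma modc_nat n : modc (n%:R : R[i]) = n%:R.
Proof. by rewrite -(rmorph_nat (real_complex R)) modc_real normr_nat. Qed.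

Lemma modc_eq0 z : (modc z == 0) = (z == 0).
Proof.
by apply/eqP/eqP => [/ComplexField.Normc.eq0_normc //|->]; rewrite modc0.
Qed.

Lemma modc_gt0 z : (0 < modc z) = (z != 0).
Proof. by rewrite lt_def modc_ge0 andbT modc_eq0. Qed.

Lemma modc_sum (I : Type) (s : seq I) (P : pred I) (f : I -> R[i]) :
  modc (\sum_(i <- s | P i) f i) <= \sum_(i <- s | P i) modc (f i).
Proof.
elim/big_ind2: _ => [|x1 x2 y1 y2 h1 h2|//]; first by rewrite modc0.
by rewrite (le_trans (modcD _ _)) ?lerD.
Qed.

Lemma modc_Re z : `|complex.Re z| <= modc z.
Proof. by case: z => x y /=; rewrite -sqrtr_sqr ler_wsqrtr ?lerDl ?sqr_ge0. Qed.

Lemma modc_Im z : `|complex.Im z| <= modc z.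
Proof. by case: z => x y /=; rewrite -sqrtr_sqr ler_wsqrtr ?lerDr ?sqr_ge0. Qed.

Lemma modc_ReIm z : modc z <= `|complex.Re z| + `|complex.Im z|.
Proof.
rewrite {1}(complexE z) (le_trans (modcD _ _))// modcM !modc_real lerD2l.
by rewrite /= expr0n add0r expr1n sqrtr1 mul1r.
Qed.

Lemma modc_sqr z : modc z ^+ 2 = complex.Re z ^+ 2 + complex.Im z ^+ 2.
Proof. by case: z => x y /=; rewrite sqr_sqrtr ?addr_ge0 ?sqr_ge0. Qed.

Lemma modc_lim_eq0 z : (forall e, 0 < e -> modc z <= e) -> z = 0.
Proof.
move=> h; apply/eqP; rewrite -modc_eq0; apply/negPn/negP => z0.
have p : 0 < modc z by rewrite lt_def z0 modc_ge0.
by have := h (modc z / 2) ltac:(by lra); lra.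
Qed.

End Modulus.

(** * Unconditional summation of complex families *)

#[local] Existing Instance totally_filter.

Section Summation.
Variable R : realType.
Implicit Types T I : choiceType.

(** A sum along the net of finite subsets.  It is a [Variant] rather than a
    definition so that the quantifiers hidden in the limit do not get in the way
    of implicit arguments and unification. *)
Variant hasSum T (f : T -> R[i]) (v : R[i]) : Prop :=
  HasSum of partial_sum (f : T -> R[i]^o) @ totally --> (v : R[i]^o).

Definition csum T (f : T -> R[i]) : R[i] :=
  summability.sum (f : T -> R[i]^o).

(** All finite partial sums are at most M.  Used with moduli, this is absolute
    summability with an explicit bound on the total; carrying the bound avoids
    infinite sums of real numbers. *)
Definition boundedSums T (g : T -> R) (M : R) : Prop :=
  forall K : {fset T}, \sum_(x <- K) g x <= M.

Lemma partial_sumE T (f : T -> R[i]) (K : {fset T}) :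
  partial_sum (f : T -> R[i]^o) K = \sum_(x <- K) f x.
Proof. by rewrite /partial_sum big_seq_fsetE. Qed.

Lemma hasSumP T (f : T -> R[i]) v :
  hasSum f v <-> forall e : R, 0 < e -> exists J : {fset T},
    forall K : {fset T}, (J `<=` K)%fset -> modc (\sum_(x <- K) f x - v) < e.
Proof.
split=> [[/cvgrPdist_lt h] e e0|h].
  have e0C : 0 < (e%:C : R[i]) by rewrite ltcR.
  have [J _ hJ] := h _ e0C.
  exists J => K JK; have := hJ K JK.
  by rewrite /= partial_sumE norm_modc ltcR modc_subC.
split; apply/cvgrPdist_lt => e; rewrite ltcE /= => /andP[/eqP e2 e1].
have [J hJ] := h _ e1; exists J => // K JK /=.
rewrite partial_sumE norm_modc modc_subC ltcE /=.
by rewrite e2 eqxx hJ.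
Qed.

Lemma hasSum_unique T (f : T -> R[i]) v w : hasSum f v -> hasSum f w -> v = w.
Proof. by move=> [hv] [hw]; apply: (norm_cvg_unique hv hw). Qed.

Lemma hasSum_csum T (f : T -> R[i]) v : hasSum f v -> csum f = v.
Proof. by case; exact: cvg_lim. Qed.

Lemma eq_hasSum T (f g : T -> R[i]) v : f =1 g -> hasSum f v -> hasSum g v.
Proof. by move=> /funext ->. Qed.

Lemma hasSum0 T : hasSum (fun _ : T => 0) 0.
Proof.
by apply/hasSumP => e e0; exists fset0 => K _; rewrite big1 // subrr modc0.
Qed.

Lemma hasSumD T (f g : T -> R[i]) v w :
  hasSum f v -> hasSum g w -> hasSum (fun x => f x + g x) (v + w).
Proof.
move=> [hf] [hg]; split.
have -> : partial_sum (fun x => f x + g x : R[i]^o)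
  = (fun K => partial_sum (f : T -> R[i]^o) K + partial_sum (g : T -> R[i]^o) K).
  by apply/funext => K; rewrite /partial_sum big_split.
exact: (cvgD hf hg).
Qed.

Lemma hasSumZ T (f : T -> R[i]) v c :
  hasSum f v -> hasSum (fun x => c * f x) (c * v).
Proof.
move=> [hf]; split.
have -> : partial_sum (fun x => c * f x : R[i]^o)
  = (fun K => (c : R[i]^o) * partial_sum (f : T -> R[i]^o) K).
  by apply/funext => K; rewrite /partial_sum mulr_sumr.
exact: cvgMl_tmp.
Qed.

Lemma hasSumN T (f : T -> R[i]) v : hasSum f v -> hasSum (fun x => - f x) (- v).
Proof.
move=> /(hasSumZ (-1)); rewrite mulN1r; apply: eq_hasSum => x.
by rewrite mulN1r.
Qed.

Lemma hasSum_sum T (J : Type) (s : seq J) (f : J -> T -> R[i]) v :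
  (forall j, hasSum (f j) (v j)) ->
  hasSum (fun x => \sum_(j <- s) f j x) (\sum_(j <- s) v j).
Proof.
move=> h; elim: s => [|j s IH].
  by rewrite big_nil; apply: eq_hasSum (hasSum0 T) => x; rewrite big_nil.
rewrite big_cons; apply: eq_hasSum (hasSumD (h j) IH) => x.
by rewrite big_cons.
Qed.

Lemma hasSum_finite T (K : {fset T}) (f : T -> R[i]) :
  (forall x, x \notin K -> f x = 0) -> hasSum f (\sum_(x <- K) f x).
Proof.
move=> f0; apply/hasSumP => e e0; exists K => K' KK'.
rewrite -(big_fset_incl _ KK') ?subrr ?modc0 // => x _; exact: f0.
Qed.

Lemma hasSum_single T (i : T) (v : R[i]) :
  hasSum (fun x => if x == i then v else 0) v.
Proof.
have := @hasSum_finite T [fset i]%fset (fun x => if x == i then v else 0).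
by rewrite big_seq_fset1 eqxx; apply => x; rewrite !inE => /negPf ->.
Qed.

Lemma hasSum_ord n (f : 'I_n -> R[i]) : hasSum f (\sum_i f i).
Proof.
have -> : \sum_i f i = \sum_(i <- [fset x in enum 'I_n]%fset) f i.
  rewrite -big_enum; apply: perm_big; apply: uniq_perm.
  - exact: enum_uniq.
  - exact: fset_uniq.
  - by move=> x; rewrite !inE.
by apply: hasSum_finite => x; rewrite !inE mem_enum.
Qed.

(** Transport along an injection e, given with a retraction g: the family must
    vanish outside the image of e, and x is in that image iff e (g x) = x. *)
Lemma hasSum_reindex (A T : choiceType) (e : A -> T) (g : T -> A)
    (f : T -> R[i]) v :
  cancel e g -> (forall x, e (g x) != x -> f x = 0) ->
  hasSum (fun a => f (e a)) v -> hasSum f v.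
Proof.
move=> eK f0 /hasSumP h; apply/hasSumP => eps eps0.
have [J hJ] := h _ eps0; exists (e @` J)%fset => K JK.
pose K' := (g @` [fset x in K | e (g x) == x])%fset.
have JK' : (J `<=` K')%fset.
  apply/fsubsetP => a aJ; apply/imfsetP; exists (e a); last by rewrite eK.
  rewrite !inE /= eK eqxx andbT; apply: (fsubsetP JK).
  by apply/imfsetP; exists a.
have := hJ _ JK'; rewrite /K' big_imfset /=; last first.
  move=> x y; rewrite !inE /= => /andP[_ /eqP ex] /andP[_ /eqP ey] gxy.
  by rewrite -ex gxy ey.
rewrite [\sum_(x <- K) f x](big_fsetID _ (fun x => e (g x) == x)) /=.
rewrite [X in _ -> modc (_ + X - v) < _]big1_fset ?addr0; last first.
  by move=> x; rewrite !inE /= => /andP[_ /f0 ->].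
suff -> : \sum_(i <- [fset x in K | e (g x) == x]%fset) f (e (g i)) =
          \sum_(i <- [fset x in K | e (g x) == x]%fset) f i by [].
by apply: eq_fbig => // x; rewrite !inE /= => /andP[_ /eqP ->].
Qed.

Lemma hasSum_succ (f : nat -> R[i]) v :
  hasSum (fun n => f n.+1) v -> hasSum f (f 0%N + v).
Proof.
move=> h.
have h1 : hasSum (fun k : nat => if k == 0%N then 0 else f k) v.
  apply: (@hasSum_reindex nat nat succn predn) => //.
  by case=> [|k] //=; rewrite eqxx.
apply: eq_hasSum (hasSumD (hasSum_single 0%N (f 0%N)) h1) => k.
by case: k => [|k] /=; rewrite ?addr0 ?add0r.
Qed.

(** Summation by packets needs no absolute convergence: a finite set K of
    packets is approximated by the finite sums over the points lying above K,
    and such sets are cofinal. *)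
Lemma hasSum_fibers T I (pi : T -> I) (f : T -> R[i]) (g : I -> R[i]) v :
  (forall i, hasSum (fun x => if pi x == i then f x else 0) (g i)) ->
  hasSum f v -> hasSum g v.
Proof.
move=> hg /hasSumP hf; apply/hasSumP => e e0.
have e20 : 0 < e / 2 by lra.
have [J0 hJ0] := hf _ e20; exists (pi @` J0)%fset => K JK.
have /hasSumP /(_ _ e20) [J1 hJ1] := hasSum_sum K hg.
pose K1 := (J0 `|` J1)%fset.
have := hJ1 K1 (fsubsetUr _ _).
have -> : \sum_(x <- K1) \sum_(j <- K) (if pi x == j then f x else 0) =
          \sum_(x <- [fset x in K1 | pi x \in K]%fset) f x.
  rewrite big_fset /= [in RHS]big_mkcond /=; apply: eq_bigr => x _.
  case: ifPn => [piK|piK].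
    rewrite (big_fsetD1 _ piK) /= eqxx big1_fset ?addr0 // => i.
    by rewrite !inE => /andP[/negPf h _]; rewrite eq_sym h.
  by rewrite big1_fset // => i iK _; case: eqP => // pii; rewrite pii iK in piK.
have JK2 : (J0 `<=` [fset x in K1 | pi x \in K])%fset.
  apply/fsubsetP => x xJ; rewrite !inE /= xJ /=; apply: (fsubsetP JK).
  by apply/imfsetP; exists x.
move: (hJ0 _ JK2); set S := (\sum_(x <- _) f x) => h1 h2.
have -> : \sum_(x <- K) g x - v = (S - v) - (S - \sum_(x <- K) g x) by ring.
by apply: le_lt_trans (modcB _ _) _; lra.
Qed.

Lemma hasSum_rows T I (f : T -> I -> R[i]) (g : T -> R[i]) v :
  (forall x, hasSum (f x) (g x)) ->
  hasSum (fun p : T * I => f p.1 p.2) v -> hasSum g v.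
Proof.
move=> hg; apply: (@hasSum_fibers _ _ (fun p : T * I => p.1)) => x.
apply: (@hasSum_reindex _ _ (fun i => (x, i)) (fun p => p.2)) => //=.
  by move=> [x' i] /=; case: (eqVneq x' x) => // ->; rewrite eqxx.
by rewrite eqxx; exact: hg.
Qed.

Lemma boundedSums_ge0 T (g : T -> R) M : boundedSums g M -> 0 <= M.
Proof. by move=> /(_ fset0); rewrite big_seq_fset0. Qed.

Lemma boundedSums_le T (g h : T -> R) M :
  (forall x, g x <= h x) -> boundedSums h M -> boundedSums g M.
Proof. by move=> gh hM K; rewrite (le_trans _ (hM K)) // ler_sum. Qed.

Lemma boundedSumsW T (g : T -> R) M N :
  M <= N -> boundedSums g M -> boundedSums g N.
Proof. by move=> MN hM K; rewrite (le_trans (hM K)). Qed.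

Lemma boundedSumsD T (g h : T -> R) M N :
  boundedSums g M -> boundedSums h N ->
  boundedSums (fun x => g x + h x) (M + N).
Proof. by move=> hM hN K; rewrite big_split lerD. Qed.

Lemma boundedSumsZ T (g : T -> R) M c : 0 <= c ->
  boundedSums g M -> boundedSums (fun x => c * g x) (c * M).
Proof. by move=> c0 hM K; rewrite -mulr_sumr ler_wpM2l. Qed.

(** A finite set of pairs is contained in the product of its two
    projections. *)
Lemma boundedSums_rows T I (f : T -> I -> R) (m : T -> R) M :
  (forall x i, 0 <= f x i) -> (forall x, boundedSums (f x) (m x)) ->
  boundedSums m M -> boundedSums (fun p : T * I => f p.1 p.2) M.
Proof.
move=> f0 fm mM K.
pose K1 := [fset p.1 | p in K]%fset; pose K2 := [fset p.2 | p in K]%fset.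
apply: le_trans (mM K1).
apply: le_trans (_ : \sum_(x <- K1) \sum_(i <- K2) f x i <= _); last first.
  by apply: ler_sum => x _; apply: fm.
rewrite (partition_big_imfset _ (fun p => p.1)) /=; apply: ler_sum => x _.
rewrite big_fset_condE; set L := [fset i in K | i.1 == x]%fset.
have Lx y : y \in L -> y.1 = x by rewrite !inE => /andP[_ /eqP].
have LK y : y \in L -> y \in K by rewrite !inE => /andP[].
move: L Lx LK => L Lx LK.
pose K3 := [fset i.2 | i in L]%fset.
have -> : \sum_(i <- L) f i.1 i.2 = \sum_(j <- K3) f x j.
  rewrite big_imfset => [|[a b] [c d] abL cdL /= bd]; last first.
    by move: (Lx _ abL) (Lx _ cdL) => /= -> ->; rewrite bd.
  by apply: eq_fbig => // y yL; rewrite (Lx _ yL).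
have K32 : (K3 `<=` K2)%fset.
  apply/fsubsetP => j /imfsetP [y /= /LK yK ->].
  by apply/imfsetP; exists y.
rewrite [leRHS](big_fsetID _ (mem K3)) /=.
rewrite [X in _ <= X + _](_ : _ = \sum_(j <- K3) f x j).
  by rewrite lerDl sumr_ge0.
by apply: eq_fbigl => j; rewrite !inE /= andb_idl // => /(fsubsetP K32).
Qed.

Lemma modc_hasSum_le T (f : T -> R[i]) v M :
  hasSum f v -> boundedSums (fun x => modc (f x)) M -> modc v <= M.
Proof.
move=> /hasSumP hf hM; apply/ler_addgt0Pr => e e0.
have [J hJ] := hf e e0; have := hJ J (fsubset_refl _).
have := hM J; have := modc_sum J xpredT f.
have := modcB (\sum_(x <- J) f x) (\sum_(x <- J) f x - v).
by rewrite opprB addrC subrK; lra.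
Qed.

Lemma hasSum_ge0_bounded T (g : T -> R) M :
  (forall x, 0 <= g x) -> boundedSums g M ->
  exists v, hasSum (fun x => (g x)%:C) v.
Proof.
move=> g0 gM.
pose S := [set y | exists K : {fset T}, y = \sum_(x <- K) g x].
have supS : has_sup S.
  split; first by exists (\sum_(x <- fset0) g x), fset0.
  by exists M => _ [K ->]; apply: gM.
exists (sup S)%:C; apply/hasSumP => e e0.
have [_ [J ->] hJ] := sup_adherent e0 supS; exists J => K JK.
rewrite -rmorph_sum -rmorphB modc_real ltr_norml.
have h1 : \sum_(x <- K) g x <= sup S by apply: ub_le_sup; [exact: supS.2|exists K].
have h2 : \sum_(x <- J) g x <= \sum_(x <- K) g x.
  rewrite [leRHS](big_fsetID _ (mem J)) /=.
  rewrite [X in _ <= X + _](_ : _ = \sum_(j <- J) g j) ?lerDl ?sumr_ge0 //.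
  by apply: eq_fbigl => j; rewrite !inE /= andb_idl // => /(fsubsetP JK).
by apply/andP; split; lra.
Qed.

Lemma hasSum_real_bounded T (g : T -> R) M :
  boundedSums (fun x => `|g x|) M -> exists v, hasSum (fun x => (g x)%:C) v.
Proof.
move=> gM.
have [v1 h1] := hasSum_ge0_bounded (fun x => normr_ge0 (g x)) gM.
have g0 x : 0 <= `|g x| - g x by rewrite subr_ge0 ler_norm.
have [|v2 h2] := @hasSum_ge0_bounded _ _ (M + M) g0.
  apply: boundedSums_le (boundedSumsD gM gM) => x.
  by rewrite lerD2l -normrN ler_norm.
exists (v1 - v2); apply: eq_hasSum (hasSumD h1 (hasSumN h2)) => x.
by rewrite rmorphB /= opprB addrC subrK.
Qed.

(** Absolutely summable families are summable: real and imaginary parts are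
    differences of bounded nonnegative families, whose sums are suprema. *)
Lemma csumP T (f : T -> R[i]) M :
  boundedSums (fun x => modc (f x)) M -> hasSum f (csum f).
Proof.
move=> fM.
have [v1 h1] := hasSum_real_bounded (boundedSums_le (fun x => modc_Re (f x)) fM).
have [v2 h2] := hasSum_real_bounded (boundedSums_le (fun x => modc_Im (f x)) fM).
have hv := hasSumD h1 (hasSumZ 'i h2).
have h : hasSum f (v1 + 'i * v2).
  by apply: eq_hasSum hv => x; rewrite -complexE.
by rewrite (hasSum_csum h).
Qed.

(** If the sums over the finite sets avoiding J are bounded by B, so are those of
    the positive and of the negative part. *)
Lemma boundedSums_tail T (g : T -> R) (J : {fset T}) B :
  (forall K : {fset T}, [disjoint J & K]%fset -> `|\sum_(x <- K) g x| <= B) ->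
  boundedSums (fun x => `|g x|) (\sum_(x <- J) `|g x| + (B + B)).
Proof.
move=> hB K; rewrite (big_fsetID _ (mem J)) /= lerD //.
  rewrite [leRHS](big_fsetID _ (mem K)) /=.
  rewrite [X in X <= _](_ : _ = \sum_(i <- [fset x in J | mem K x]%fset) `|g i|).
    by rewrite lerDl sumr_ge0.
  by apply: eq_fbigl => x; rewrite !inE /= andbC.
set L := [fset x in K | _]%fset.
rewrite (big_fsetID _ (fun x => 0 <= g x)) /=.
have hd (P : pred T) : [disjoint J & [fset x in L | P x]]%fset.
  rewrite fdisjoint_sym; apply/fdisjointP => x; rewrite !inE /=.
  by case/andP=> /andP[].
rewrite lerD //.
  apply: le_trans (hB _ (hd (fun x => 0 <= g x))).
  rewrite [leRHS]ger0_norm ?big_seq ?sumr_ge0 //=.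
    by apply: ler_sum => x; rewrite !inE /= => /andP[_ /ger0_norm ->].
  by move=> x; rewrite !inE /= => /andP[].
apply: le_trans (hB _ (hd (fun x => ~~ (0 <= g x)))).
rewrite -[leRHS]normrN -sumrN [leRHS]ger0_norm ?big_seq ?sumr_ge0 //=.
  apply: ler_sum => x; rewrite !inE /= -ltNge => /andP[_ /ltW/ler0_norm ->].
  by rewrite lexx.
by move=> x; rewrite !inE /= -ltNge => /andP[_ /ltW]; rewrite oppr_ge0.
Qed.

(** In finite dimension unconditional convergence forces absolute convergence,
    by the Cauchy criterion applied to real and imaginary parts. *)
Lemma hasSum_bounded T (f : T -> R[i]) v :
  hasSum f v -> exists M, boundedSums (fun x => modc (f x)) M.
Proof.
move=> /hasSumP /(_ 1 ltr01) [J hJ].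
have hB (K : {fset T}) : [disjoint J & K]%fset -> modc (\sum_(x <- K) f x) <= 2.
  move=> JK; have := hJ _ (fsubsetUl J K); have := hJ _ (fsubset_refl J).
  set a := modc _; set b := modc _ => h1 h2.
  apply: le_trans (_ : b + a <= _); last by lra.
  apply: le_trans (modcB _ _).
  rewrite opprB addrA subrK.
  rewrite (big_fsetID _ (mem J) (J `|` K)%fset) /=.
  rewrite (_ : \sum_(i <- [fset x in (J `|` K)%fset | mem J x]%fset) f i =
    \sum_(x <- J) f x); last first.
    by apply: eq_fbigl => x; rewrite !inE /=; case: (x \in J); rewrite ?andbF.
  rewrite addrC addKr (_ : \sum_(i <- [fset x in (J `|` K)%fset | ~~ mem J x]%fset) f i =
    \sum_(x <- K) f x) //.
  apply: eq_fbigl => x; rewrite !inE /=; case: (boolP (x \in J)) => xJ /=.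
    by rewrite (negPf (fdisjointP JK _ xJ)).
  by rewrite andbT.
have h1 := @boundedSums_tail _ (fun x => complex.Re (f x)) J 2.
have h2 := @boundedSums_tail _ (fun x => complex.Im (f x)) J 2.
have ReS K : \sum_(x <- K) complex.Re (f x) = complex.Re (\sum_(x <- K) f x).
  by rewrite (raddf_sum (@complex.Re R : Rcomplex R -> R)).
have ImS K : \sum_(x <- K) complex.Im (f x) = complex.Im (\sum_(x <- K) f x).
  by rewrite (raddf_sum (@complex.Im R : Rcomplex R -> R)).
have {}h1 := h1 (fun K d => eq_ind_r (fun z => `|z| <= 2) (le_trans (modc_Re _) (hB K d)) (ReS K)).
have {}h2 := h2 (fun K d => eq_ind_r (fun z => `|z| <= 2) (le_trans (modc_Im _) (hB K d)) (ImS K)).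
by eexists; apply: boundedSums_le (boundedSumsD h1 h2) => x; apply: modc_ReIm.
Qed.

(** The bound on the moduli of the packet sums comes from multiplying each
    packet by a phase that makes its sum nonnegative: the total over a finite set
    of packets is then the sum of a family dominated by f. *)
Lemma csum_fibers T I (pi : T -> I) (f : T -> R[i]) M :
  boundedSums (fun x => modc (f x)) M ->
  let fib i := csum (fun x => if pi x == i then f x else 0) in
  hasSum fib (csum f) /\ boundedSums (fun i => modc (fib i)) M.
Proof.
move=> fM fib.
have hfib i : hasSum (fun x => if pi x == i then f x else 0) (fib i).
  apply: csumP (boundedSums_le _ fM) => x.
  by case: ifP => // _; rewrite modc0 modc_ge0.
split; first exact: hasSum_fibers hfib (csumP fM).
move=> K.
(* The phase conjugate to that of the packet sum. *)
pose c i : R[i] := if fib i == 0 then 0 else (modc (fib i))%:C / fib i.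
have cfib i : c i * fib i = (modc (fib i))%:C.
  rewrite /c; case: eqVneq => [->|h]; first by rewrite mulr0 modc0.
  by rewrite divfK.
have c1 i : modc (c i) <= 1.
  rewrite /c; case: eqVneq => [_|h]; first by rewrite modc0.
  rewrite modcf modc_real ger0_norm ?modc_ge0 // divff // modc_eq0.
  exact: h.
have h := hasSum_sum K (fun i => hasSumZ (c i) (hfib i)).
have : modc (\sum_(j <- K) c j * fib j) <= M.
  apply: modc_hasSum_le h _; apply: boundedSums_le fM => x.
  case: (boolP (pi x \in K)) => [piK|piK].
    rewrite (big_fsetD1 _ piK) /= eqxx big1_fset ?addr0 // => [|i].
      by rewrite modcM ler_piMl ?modc_ge0.
    by rewrite !inE => /andP[/negPf h' _] _; rewrite eq_sym h' mulr0.
  rewrite big1_fset ?modc0 ?modc_ge0 // => i iK _.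
  case: eqP => [pii|_]; rewrite ?mulr0 //; by rewrite pii iK in piK.
rewrite (eq_bigr _ (fun i _ => cfib i)) -rmorph_sum modc_real ger0_norm //.
by rewrite sumr_ge0 // => i _; rewrite modc_ge0.
Qed.

Lemma boundedSumsM T I (f : T -> R[i]) (g : I -> R[i]) M N :
  boundedSums (fun x => modc (f x)) M -> boundedSums (fun x => modc (g x)) N ->
  boundedSums (fun p : T * I => modc (f p.1 * g p.2)) (M * N).
Proof.
move=> fM gN; have N0 := boundedSums_ge0 gN.
apply: (@boundedSums_rows _ _ (fun x i => modc (f x * g i)) (fun x => N * modc (f x))).
- by move=> x i; apply: modc_ge0.
- move=> x; have := boundedSumsZ (modc_ge0 (f x)) gN; rewrite mulrC.
  by apply: boundedSums_le => i; rewrite modcM.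
- by rewrite mulrC; apply: boundedSumsZ.
Qed.

Lemma hasSumM T I (f : T -> R[i]) (g : I -> R[i]) v w M N :
  boundedSums (fun x => modc (f x)) M -> boundedSums (fun x => modc (g x)) N ->
  hasSum f v -> hasSum g w -> hasSum (fun p : T * I => f p.1 * g p.2) (v * w).
Proof.
move=> fM gN hf hg; have h := csumP (boundedSumsM fM gN).
suff <- : csum (fun p : T * I => f p.1 * g p.2) = v * w by [].
apply: (@hasSum_unique _ (fun x => w * f x)); last first.
  by rewrite mulrC; apply: hasSumZ.
apply: (hasSum_rows (f := fun x i => f x * g i) _ h) => x.
by rewrite mulrC; apply: hasSumZ.
Qed.

End Summation.

(** * Taylor expansions on discs and continuation along a segment *)

Section Taylor.
Variable R : realType.
Implicit Types (f g w : R[i] -> R[i]) (a h z : R[i]) (d M N r : R).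

Lemma boundedSums_nat (g : nat -> R) M :
  (forall n, 0 <= g n) -> (forall n, \sum_(k < n) g k <= M) -> boundedSums g M.
Proof.
move=> g0 gM K; apply: le_trans (gM (\max_(x <- K) x.+1)%N).
set n := (\max_(x <- K) x.+1)%N.
have Kn : {subset K <= [fset k | k in iota 0 n]%fset}.
  move=> x xK; rewrite !inE /= mem_iota /= add0n /n (big_fsetD1 _ xK) /=.
  exact: leq_maxl.
have -> : \sum_(k < n) g k = \sum_(k <- [fset k | k in iota 0 n]%fset) g k.
  rewrite -(big_mkord xpredT) /index_iota subn0; apply: perm_big.
  apply: uniq_perm; rewrite ?iota_uniq ?fset_uniq // => x.
  by rewrite !inE.
rewrite [leRHS](big_fsetID _ (mem K)) /=.
rewrite [X in _ <= X + _](_ : _ = \sum_(j <- K) g j) ?lerDl ?sumr_ge0 //.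
by apply: eq_fbigl => j; rewrite !inE /= andb_idl // => /Kn; rewrite !inE.
Qed.

Lemma boundedSums_geometric r :
  0 <= r -> r < 1 -> boundedSums (fun k : nat => r ^+ k) (1 - r)^-1.
Proof.
move=> r0 r1; apply: boundedSums_nat => [n|n]; first exact: exprn_ge0.
have p : 0 < 1 - r by lra.
rewrite -[leRHS]mul1r ler_pdivlMr // mulrC.
have -> : (1 - r) * \sum_(k < n) r ^+ k = 1 - r ^+ n.
  by rewrite -opprB mulNr -subrX1 opprB.
by have := exprn_ge0 n r0; lra.
Qed.

Lemma hasSum_geometric z :
  modc z < 1 -> hasSum (fun k : nat => z ^+ k) (1 - z)^-1.
Proof.
move=> z1; have h := @csumP R nat (fun k : nat => z ^+ k) (1 - modc z)^-1.
have {}h : hasSum (fun k : nat => z ^+ k) (csum (fun k : nat => z ^+ k)).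
  apply: h; apply: boundedSums_le (boundedSums_geometric (modc_ge0 z) z1) => k.
  by rewrite modcX.
set v := csum _ in h *.
have e : 1 + z * v = v.
  apply: (hasSum_unique _ h); apply: (hasSum_succ (f := fun k => z ^+ k)).
  by apply: eq_hasSum (hasSumZ z h) => k; rewrite exprS.
have z0 : 1 - z != 0.
  by rewrite subr_eq0; apply: contraL z1 => /eqP <-; rewrite modc1 ltxx.
have -> : (1 - z)^-1 = v; last exact: h.
by apply: (mulfI z0); rewrite divff // mulrBl mul1r -{1}e addrK.
Qed.

(** The packets p l + j = n of pairs (l, j); for p = 1 they are the
    antidiagonals of the Cauchy product. *)
Lemma hasSum_packets p (F : nat * nat -> R[i]) (v : R[i]) M : (0 < p)%N ->
  boundedSums (fun q => modc (F q)) M -> hasSum F v ->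
  let conv n := \sum_(l < (n %/ p).+1) F (l : nat, n - p * l)%N in
  hasSum conv v /\ boundedSums (fun n => modc (conv n)) M.
Proof.
move=> p0 FM hF conv.
pose pi (q : nat * nat) := (p * q.1 + q.2)%N.
suff E n : csum (fun q => if pi q == n then F q else 0) = conv n.
  have [h1 h2] := csum_fibers pi FM.
  rewrite -(hasSum_csum hF); split.
    by apply: eq_hasSum h1 => n; rewrite E.
  by apply: boundedSums_le h2 => n; rewrite E.
apply: hasSum_csum.
apply: (@hasSum_reindex _ 'I_(n %/ p).+1 _ (fun l => (l : nat, n - p * l)%N)
  (fun q => inord q.1)).
- by move=> l /=; rewrite inord_val.
- move=> [l j] /=; rewrite /pi /=; case: (eqVneq (p * l + j)%N n) => // <-.
  rewrite inordK; first by rewrite addKn eqxx.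
  by rewrite mulnC divnMDl // ltnS leq_addr.
- apply: eq_hasSum (hasSum_ord (fun l : 'I__ => F (l : nat, n - p * l)%N)) => l.
  rewrite /pi /= subnKC ?eqxx //.
  by rewrite mulnC -leq_divRL // -ltnS.
Qed.

Lemma hasSum_convolution p (f g : nat -> R[i]) (v w : R[i]) M N : (0 < p)%N ->
  boundedSums (fun k => modc (f k)) M -> boundedSums (fun k => modc (g k)) N ->
  hasSum f v -> hasSum g w ->
  let conv n := \sum_(l < (n %/ p).+1) f l * g (n - p * l)%N in
  hasSum conv (v * w) /\ boundedSums (fun n => modc (conv n)) (M * N).
Proof.
move=> p0 fM gN hf hg.
exact: hasSum_packets p0 (boundedSumsM fM gN) (hasSumM fM gN hf hg).
Qed.

Lemma hasSum_cauchy (f g : nat -> R[i]) (v w : R[i]) M N :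
  boundedSums (fun k => modc (f k)) M -> boundedSums (fun k => modc (g k)) N ->
  hasSum f v -> hasSum g w ->
  let conv n := \sum_(l < n.+1) f l * g (n - l)%N in
  hasSum conv (v * w) /\ boundedSums (fun n => modc (conv n)) (M * N).
Proof.
move=> fM gN hf hg.
have [h1 h2] := hasSum_convolution (ltn0Sn 0) fM gN hf hg.
split; [apply: eq_hasSum h1 | apply: boundedSums_le h2] => n; rewrite divn1.
  by apply: eq_bigr => l _; rewrite mul1n.
by rewrite [leRHS](_ : _ = modc (\sum_(l < n.+1) f l * g (n - l)%N)) //;
  congr modc; apply: eq_bigr => l _; rewrite mul1n.
Qed.

(** On the closed disc of centre a and radius d, f is the sum of a power series
    in h whose Wiener norm is at most M.  These norms are submultiplicative and
    dominate the sup norm, so they control compositions of power series. *)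
Definition taylorOn f a d M : Prop :=
  exists u : nat -> R[i],
    boundedSums (fun k => modc (u k * d%:C ^+ k)) M /\
    forall h, modc h <= d -> hasSum (fun k => u k * h ^+ k) (f (a + h)).

Lemma boundedSums_disc (u : nat -> R[i]) d M h :
  boundedSums (fun k => modc (u k * d%:C ^+ k)) M -> modc h <= d ->
  boundedSums (fun k => modc (u k * h ^+ k)) M.
Proof.
move=> uM hd; apply: boundedSums_le uM => k.
rewrite !modcM !modcX ler_wpM2l ?modc_ge0 // lerXn2r ?nnegrE ?modc_ge0 //.
by rewrite modc_real (le_trans hd) // ler_norm.
Qed.

Lemma taylorOn_le f a d M h : taylorOn f a d M -> modc h <= d -> modc (f (a + h)) <= M.
Proof.
move=> [u [uM hu]] hd; apply: modc_hasSum_le (hu _ hd) _.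
exact: boundedSums_disc uM hd.
Qed.

Lemma taylorOn_cst a d c : taylorOn (fun=> c) a d (modc c).
Proof.
exists (fun k => if k == 0%N then c else 0); split.
  move=> K; case: (boolP (0%N \in K)) => K0.
    rewrite (big_fsetD1 _ K0) /= expr0 mulr1 big1_fset ?addr0 // => i.
    by rewrite !inE => /andP[/negPf -> _] _; rewrite mul0r modc0.
  rewrite big1_fset ?modc_ge0 // => i iK _.
  by case: eqP => [i0|]; rewrite ?mul0r ?modc0 //; rewrite i0 (negPf K0) in iK.
move=> h _; apply: eq_hasSum (hasSum_single 0%N c) => k.
by case: k => [|k] /=; rewrite ?expr0 ?mulr1 ?mul0r.
Qed.

Lemma taylorOnM f g a d M N : 0 <= d ->
  taylorOn f a d M -> taylorOn g a d N -> taylorOn (fun z => f z * g z) a d (M * N).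
Proof.
move=> d0 [u [uM hu]] [v [vN hv]].
pose w n := \sum_(l < n.+1) u l * v (n - l)%N.
have wE h n : w n * h ^+ n =
    \sum_(l < n.+1) (u l * h ^+ l) * (v (n - l)%N * h ^+ (n - l)).
  rewrite mulr_suml; apply: eq_bigr => l _.
  by rewrite mulrACA -exprD subnKC // -ltnS.
have conv h : modc h <= d ->
    hasSum (fun k => w k * h ^+ k) (f (a + h) * g (a + h)) /\
    boundedSums (fun k => modc (w k * h ^+ k)) (M * N).
  move=> hd.
  have [] := hasSum_cauchy (boundedSums_disc uM hd) (boundedSums_disc vN hd)
    (hu _ hd) (hv _ hd).
  move=> h1 h2; split; first by apply: eq_hasSum h1 => n; rewrite wE.
  by apply: boundedSums_le h2 => n; rewrite wE.
exists w; split=> [|h hd]; last exact: (conv h hd).1.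
by apply: (conv d%:C _).2; rewrite modc_real ger0_norm.
Qed.

Lemma taylorOnX f a d M n : 0 <= d ->
  taylorOn f a d M -> taylorOn (fun z => f z ^+ n) a d (M ^+ n).
Proof.
move=> d0 hf; elim: n => [|n IH].
  by have := taylorOn_cst a d 1; rewrite modc1.
rewrite exprS; have [u [h1 h2]] := taylorOnM d0 hf IH.
by exists u; split=> // h hd; rewrite exprS; apply: h2.
Qed.

Lemma taylorOnB f g a d M N :
  taylorOn f a d M -> taylorOn g a d N -> taylorOn (fun z => f z - g z) a d (M + N).
Proof.
move=> [u [uM hu]] [v [vN hv]]; exists (fun k => u k - v k); split.
  apply: boundedSums_le (boundedSumsD uM vN) => k.
  by rewrite mulrBl modcB.
move=> h hd; apply: eq_hasSum (hasSumD (hu _ hd) (hasSumN (hv _ hd))) => k.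
by rewrite mulrBl.
Qed.

Lemma taylorOn_id a d : 0 <= d -> taylorOn id a d (modc a + d).
Proof.
move=> d0; exists (fun k => if k == 0%N then a else if k == 1%N then 1 else 0).
have E h : hasSum (fun k => (if k == 0%N then a else if k == 1%N then 1 else 0)
    * h ^+ k) (a + h).
  have := @hasSum_finite R nat [fset 0%N; 1%N]%fset
    (fun k => (if k == 0%N then a else if k == 1%N then 1 else 0) * h ^+ k).
  rewrite big_fsetU1 /= ?inE // big_seq_fset1 /= expr0 mulr1 mul1r expr1; apply.
  by move=> x; rewrite !inE negb_or => /andP[/negPf -> /negPf ->]; rewrite mul0r.
split=> [|h _]; last exact: E.
have B k : modc ((if k == 0%N then a else if k == 1%N then 1 else 0) * d%:C ^+ k)
    = if k == 0%N then modc a else if k == 1%N then d else 0.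
  case: k => [|[|k]]; first by rewrite expr0 mulr1.
    by rewrite mul1r modcX modc_real expr1 ger0_norm.
  by rewrite mul0r modc0.
apply: boundedSums_nat => n; first exact: modc_ge0.
under eq_bigr do rewrite B.
case: n => [|[|n]]; rewrite ?big_ord0 ?big_ord_recl /= ?big_ord_recl /=.
- by rewrite addr_ge0 ?modc_ge0.
- by rewrite big_ord0 addr0 lerDl.
by rewrite big1 ?addr0.
Qed.

(** Weierstrass' double series theorem. *)
Lemma taylorOn_sum (F : nat -> R[i] -> R[i]) (m : nat -> R) f a d B :
  0 < d -> (forall n, taylorOn (F n) a d (m n)) -> boundedSums m B ->
  (forall h, modc h <= d -> hasSum (fun n => F n (a + h)) (f (a + h))) ->
  taylorOn f a d B.
Proof.
move=> d0 hF mB hf.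
have [u hu] := choice hF.
have bnd h : modc h <= d ->
    boundedSums (fun p : nat * nat => modc (u p.1 p.2 * h ^+ p.2)) B.
  move=> hd.
  apply: (@boundedSums_rows _ _ _ (fun n k => modc (u n k * h ^+ k)) m) => //.
    by move=> n k; apply: modc_ge0.
  by move=> n; apply: boundedSums_disc (hu n).1 hd.
have dd : modc (d%:C : R[i]) <= d by rewrite modc_real gtr0_norm.
pose v k := csum (fun n => u n k).
have hv k : hasSum (fun n => u n k) (v k).
  apply: (@csumP _ _ _ (d ^- k * B)) => K.
  have dk : 0 < d ^+ k by rewrite exprn_gt0.
  rewrite mulrC ler_pdivlMr // mulr_suml.
  have := bnd _ dd [fset (n, k) | n in K]%fset.
  rewrite big_imfset /=; last by move=> x y _ _ [].
  apply: le_trans; apply: ler_sum => n _.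
  by rewrite modcM modcX modc_real gtr0_norm.
have main h : modc h <= d -> hasSum (fun k => v k * h ^+ k) (f (a + h)) /\
    boundedSums (fun k => modc (v k * h ^+ k)) B.
  move=> hd.
  have E k : csum (fun x : nat * nat =>
      if x.2 == k then u x.1 x.2 * h ^+ x.2 else 0) = v k * h ^+ k.
    apply: hasSum_csum.
    apply: (@hasSum_reindex _ _ _ (fun n => (n, k)) (fun p => p.1)) => //=.
      by move=> [n k'] /=; case: (eqVneq k' k) => // ->; rewrite eqxx.
    rewrite eqxx mulrC; apply: eq_hasSum (hasSumZ (h ^+ k) (hv k)) => n.
    by rewrite mulrC.
  have [h1 h2] := csum_fibers (fun p : nat * nat => p.2) (bnd _ hd).
  have <- : csum (fun x : nat * nat => u x.1 x.2 * h ^+ x.2) = f (a + h).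
    apply: hasSum_unique (hf _ hd).
    apply: (hasSum_rows (f := fun n k => u n k * h ^+ k)) (csumP (bnd _ hd)) => n.
    exact: (hu n).2.
  split; first by apply: eq_hasSum h1 => k; rewrite E.
  by apply: boundedSums_le h2 => k; rewrite E.
exists v; split=> [|h hd]; last exact: (main h hd).1.
exact: (main _ dd).2.
Qed.

Definition pser (c : nat -> R[i]) z : R[i] := csum (fun n => c n * z ^+ n).

Lemma pserP (c : nat -> R[i]) z r M :
  boundedSums (fun n => modc (c n) * r ^+ n) M -> modc z <= r ->
  hasSum (fun n => c n * z ^+ n) (pser c z).
Proof.
move=> cM zr; apply: (@csumP _ _ _ M); apply: boundedSums_le cM => n.
by rewrite modcM modcX ler_wpM2l ?modc_ge0 // lerXn2r ?nnegrE ?modc_ge0 //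
  (le_trans (modc_ge0 _) zr).
Qed.

(** Composition with a power series: only the Wiener norm of the inner function
    has to stay within the radius of convergence. *)
Lemma taylorOn_pser (c : nat -> R[i]) w a d r m B :
  0 < d -> taylorOn w a d m -> m <= r ->
  boundedSums (fun n => modc (c n) * r ^+ n) B ->
  taylorOn (fun z => pser c (w z)) a d B.
Proof.
move=> d0 hw mr cB.
have m0 : 0 <= m.
  by apply: le_trans (modc_ge0 _) (taylorOn_le hw (h := 0) _); rewrite modc0 ltW.
apply: (@taylorOn_sum (fun n z => c n * w z ^+ n) (fun n => modc (c n) * m ^+ n)) => //.
- move=> n; apply: (taylorOnM (ltW d0) (taylorOn_cst a d (c n))).
  exact: taylorOnX (ltW d0) hw.
- apply: boundedSums_le cB => n; rewrite ler_wpM2l ?modc_ge0 //.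
  by rewrite lerXn2r ?nnegrE // (le_trans m0).
- move=> h hd; apply: pserP cB _.
  exact: le_trans (taylorOn_le hw hd) mr.
Qed.

(** Expansion of 1 / (q - t h), where q = 1 - t a, as a geometric series. *)
Lemma taylorOn_inv t a d : 0 <= d -> modc t * d < modc (1 - t * a) ->
  taylorOn (fun z => (1 - t * z)^-1) a d (modc (1 - t * a) - modc t * d)^-1.
Proof.
move=> d0; set q := 1 - t * a => tq.
have q0 : 0 < modc q by apply: le_lt_trans tq; rewrite mulr_ge0 ?modc_ge0.
have q0' : q != 0 by rewrite -modc_gt0.
have small h : modc h <= d -> modc (t * h / q) < 1.
  move=> hd; rewrite modcf modcM ltr_pdivrMr // mul1r.
  by apply: le_lt_trans tq; rewrite ler_wpM2l ?modc_ge0.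
exists (fun k => q^-1 * (t / q) ^+ k); split.
  have E k : modc (q^-1 * (t / q) ^+ k * d%:C ^+ k) =
      (modc q)^-1 * (modc t * d / modc q) ^+ k.
    rewrite -mulrA -exprMn modcM modcV modcX 2!modcM modcV modc_real ger0_norm //.
    by rewrite mulrAC.
  have r0 : 0 <= modc t * d / modc q.
    by rewrite divr_ge0 ?mulr_ge0 ?modc_ge0.
  have r1 : modc t * d / modc q < 1 by rewrite ltr_pdivrMr // mul1r.
  have iq0 : 0 <= (modc q)^-1 by rewrite invr_ge0 modc_ge0.
  have := boundedSumsZ iq0 (boundedSums_geometric r0 r1).
  have -> : (modc q)^-1 * (1 - modc t * d / modc q)^-1 = (modc q - modc t * d)^-1.
    by rewrite -invfM mulrBr mulr1 mulrCA divff ?mulr1 // gt_eqF.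
  by apply: boundedSums_le => k; rewrite E.
move=> h hd.
have -> : (1 - t * (a + h))^-1 = q^-1 * (1 - t * h / q)^-1.
  by rewrite -invfM mulrBr mulr1 mulrCA divff // mulr1 /q mulrDr opprD addrA.
apply: eq_hasSum (hasSumZ q^-1 (hasSum_geometric (small _ hd))) => k.
by rewrite -[RHS]mulrA -exprMn; congr (_ * _ ^+ _); rewrite mulrAC.
Qed.

(** If u m is the first nonzero coefficient, then u m h^m equals minus the
    remainder, which is O(h^(m+1)); dividing by h^m and letting h tend to 0 gives
    u m = 0. *)
Lemma power_series_eq0 (u : nat -> R[i]) d M e : 0 < d -> 0 < e ->
  boundedSums (fun k => modc (u k * d%:C ^+ k)) M ->
  (forall h, modc h <= e -> hasSum (fun k => u k * h ^+ k) 0) ->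
  forall k, u k = 0.
Proof.
move=> d0 e0 uM hu; elim/ltn_ind => m IH.
have M0 := boundedSums_ge0 uM.
have key x : 0 < x -> x <= e -> x <= d -> modc (u m) * d ^+ m.+1 <= M * x.
  move=> x0 xe xd.
  have nx : modc (x%:C : R[i]) = x by rewrite modc_real gtr0_norm.
  have hx : hasSum (fun k => u k * x%:C ^+ k) 0 by apply: hu; rewrite nx.
  have hm := hasSum_single m (u m * x%:C ^+ m).
  have := hasSumD hx (hasSumN hm); rewrite add0r => hr.
  have r0 : 0 <= x / d by rewrite divr_ge0 ?ltW.
  have xd1 : x / d <= 1 by rewrite ler_pdivrMr // mul1r.
  have h : modc (- (u m * x%:C ^+ m)) <= (x / d) ^+ m.+1 * M.
    apply: modc_hasSum_le hr _.
    apply: boundedSums_le (boundedSumsZ (exprn_ge0 m.+1 r0) uM) => k.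
    have [km|mk|->] := ltngtP k m.
    - by rewrite IH // !mul0r oppr0 addr0 modc0 mulr0.
    - rewrite oppr0 addr0 !modcM !modcX nx modc_real gtr0_norm // mulrCA.
      rewrite ler_wpM2l ?modc_ge0 //.
      have -> : x ^+ k = (x / d) ^+ k * d ^+ k.
        by rewrite -exprMn divfK // gt_eqF.
      rewrite ler_wpM2r ?exprn_ge0 ?(ltW d0) //.
      by rewrite -(subnKC mk) exprD ler_piMr ?exprn_ge0 ?exprn_ile1.
    - by rewrite subrr modc0 mulr_ge0 ?exprn_ge0 ?modc_ge0.
  move: h; rewrite modcN modcM modcX nx => h.
  have xm : 0 < x ^+ m by rewrite exprn_gt0.
  rewrite -(ler_pM2r xm) mulrAC.
  have -> : M * x * x ^+ m = (x / d) ^+ m.+1 * M * d ^+ m.+1.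
    by rewrite [RHS]mulrAC -exprMn divfK ?gt_eqF // exprS -mulrA mulrC.
  by rewrite ler_pM2r // exprn_gt0.
apply: modc_lim_eq0 => eps eps0.
have dm : 0 < d ^+ m.+1 by rewrite exprn_gt0.
(* With this choice M x <= M y <= eps d^(m+1). *)
pose y := eps * d ^+ m.+1 / (M + 1).
have y0 : 0 < y by rewrite divr_gt0 ?mulr_gt0 //; lra.
pose x := Num.min y (Num.min e d).
have x0 : 0 < x by rewrite !lt_min y0 e0 d0.
have := key x x0; rewrite /x !ge_min !lexx !orbT => /(_ isT isT).
move=> h; rewrite -(ler_pM2r dm); apply: (le_trans h).
apply: le_trans (_ : M * y <= _).
  by rewrite ler_wpM2l // ge_min lexx.
rewrite /y mulrCA -[leRHS]mulr1 ler_wpM2l ?mulr_ge0 ?ltW //.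
by rewrite ltr_pdivrMr; lra.
Qed.

(** Identity theorem along a segment.  A uniform radius d of expansion lets finitely
    many steps of length d / 2 carry the zero set from 0 to any point. *)
Lemma taylor_continuation f d e s : 0 < d -> 0 < e ->
  (forall x : R, 0 <= x <= s -> exists M, taylorOn f x%:C d M) ->
  (forall h, modc h <= e -> f h = 0) ->
  forall x : R, 0 <= x <= s -> f x%:C = 0.
Proof.
move=> d0 e0 hT h0.
have spread (x e' : R) : 0 <= x <= s -> 0 < e' ->
    (forall h, modc h <= e' -> f (x%:C + h) = 0) ->
    forall h, modc h <= d -> f (x%:C + h) = 0.
  move=> xs e'0 hx; have [M [u [uM hu]]] := hT x xs.
  pose e1 := Num.min e' d.
  have e10 : 0 < e1 by rewrite lt_min e'0 d0.
  have u0 : forall k, u k = 0.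
    apply: (power_series_eq0 d0 e10 uM) => h; rewrite le_min => /andP[h1 h2].
    by rewrite -(hx _ h1); apply: hu.
  move=> h hd; apply: (hasSum_unique (hu _ hd)).
  by apply: eq_hasSum (hasSum0 R nat) => k; rewrite u0 mul0r.
have step n : forall x : R, 0 <= x <= s -> x <= n%:R * (d / 2) ->
    forall h, modc h <= d -> f (x%:C + h) = 0.
  elim: n => [|n IH] x xs xn.
    have x0 : x = 0 by move: xs; lra.
    apply: (spread _ e) => // h he; rewrite x0 add0r; exact: h0.
  apply: (spread _ (d / 2)) => //; first by lra.
  move=> h hd; pose x' := Num.max 0 (x - d / 2).
  have x'x : 0 <= x - x' <= d / 2.
    by rewrite /x'; case: (leP 0 (x - d / 2)) => ?; move: xs; lra.
  have -> : x%:C + h = x'%:C + ((x - x')%:C + h).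
    by rewrite addrA -rmorphD /= subrKC.
  apply: IH.
  - by rewrite /x'; case: (leP 0 (x - d / 2)) => ?; move: xs; lra.
  - move: xn; rewrite -natr1 mulrDl mul1r /x'.
    case: (leP 0 (x - d / 2)) => ? ?; first by lra.
    by rewrite mulr_ge0 ?ler0n //; lra.
  - apply: le_trans (modcD _ _) _; rewrite modc_real ger0_norm; move: x'x; lra.
move=> x xs; have [n xn] : exists n : nat, x <= n%:R * (d / 2).
  exists (Num.truncn (x / (d / 2))).+1; rewrite -ler_pdivrMr; last by lra.
  by rewrite ltW // truncnS_gt.
have := step n x xs xn 0; rewrite addr0; apply.
by rewrite modc0 ltW.
Qed.

End Taylor.

(** * Abel's limit theorem and continuity of power series *)

Section Abel.
Variable R : realType.
Implicit Types (z : R[i]) (d M r e s : R).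

Lemma cvgn_modcP (u : nat -> R[i]) v :
  ((u : nat -> R[i]^o) @ \oo --> (v : R[i]^o)) <->
  forall e, 0 < e -> exists N, forall n, (N <= n)%N -> modc (u n - v) < e.
Proof.
split=> [/cvgrPdist_lt h e e0|h].
  have e0C : 0 < (e%:C : R[i]) by rewrite ltcR.
  have [N _ hN] := h e%:C e0C; exists N => n Nn; have := hN n Nn.
  by rewrite /= norm_modc ltcR modc_subC.
apply/cvgrPdist_lt => e; rewrite ltcE /= => /andP[/eqP e2 e1].
have [N hN] := h _ e1; exists N => // n /= Nn.
by rewrite norm_modc modc_subC ltcE /= e2 eqxx hN.
Qed.

Lemma cvg_left1 (f : R -> R[i]) v :
  (forall e, 0 < e -> exists2 d, 0 < d & forall s, 0 <= s -> s < 1 -> 1 - d < s ->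
     modc (f s - v) < e) ->
  (f s : R[i]^o) @[s --> 1^'-] --> (v : R[i]^o).
Proof.
move=> h; apply/cvgrPdist_lt => e; rewrite ltcE /= => /andP[/eqP e2 e1].
have [d d0 hd] := h _ e1.
near=> s; rewrite norm_modc modc_subC ltcE /= e2 eqxx /=; apply: hd.
- by near: s; apply: nbhs_left_ge; rewrite ltr01.
- by near: s; apply: nbhs_left_lt.
- by near: s; apply: nbhs_left_gt; rewrite ltrBlDr ltrDl.
Unshelve. all: by end_near. Qed.

Lemma bounded_coef_pser (c : nat -> R[i]) B r : 0 <= r -> r < 1 ->
  (forall n, modc (c n) <= B) ->
  boundedSums (fun n => modc (c n) * r ^+ n) (B * (1 - r)^-1).
Proof.
move=> r0 r1 cB; have B0 : 0 <= B by apply: le_trans (modc_ge0 _) (cB 0%N).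
apply: boundedSums_le (boundedSumsZ B0 (boundedSums_geometric r0 r1)) => n.
by rewrite ler_wpM2r ?exprn_ge0.
Qed.

Lemma cvgn_bounded (u : nat -> R[i]) v :
  (u : nat -> R[i]^o) @ \oo --> (v : R[i]^o) -> exists B, forall n, modc (u n) <= B.
Proof.
move=> /cvgn_modcP /(_ 1 ltr01) [N hN].
exists (\sum_(k < N) modc (u k) + (modc v + 1)) => n.
have S0 : 0 <= \sum_(k < N) modc (u k) by rewrite sumr_ge0 // => k _; apply: modc_ge0.
have v0 := modc_ge0 v.
case: (ltnP n N) => nN.
  rewrite (bigD1 (Ordinal nN)) //= -addrA lerDl addr_ge0 ?addr_ge0 //.
  by rewrite sumr_ge0 // => k _; apply: modc_ge0.
by have := hN n nN; have := modc_subr_ge (u n) v; lra.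
Qed.

Lemma series_coef_bounded (c : nat -> R[i]) v :
  series (c : nat -> R[i]^o) @ \oo --> (v : R[i]^o) ->
  exists B, forall n, modc (c n) <= B.
Proof.
move=> /cvgn_bounded[B hB]; exists (B + B) => n.
have -> : c n = series (c : nat -> R[i]^o) n.+1 - series (c : nat -> R[i]^o) n.
  by rewrite /series /= [X in _ = X - _]big_nat_recr //= addrAC subrr add0r.
by rewrite (le_trans (modcB _ _)) // lerD.
Qed.

(** With D n the difference between the partial sum of index n and the limit v,
    summation by parts gives c(s) - v = (1 - s) sum_n D_n s^n; the terms
    beyond a large index contribute at most e / 2, and the others are
    multiplied by 1 - s. *)
Theorem abel_limit (c : nat -> R[i]) v :
  series (c : nat -> R[i]^o) @ \oo --> (v : R[i]^o) ->
  forall e, 0 < e -> exists2 d, 0 < d & forall s, 0 <= s -> s < 1 -> 1 - d < s ->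
    modc (pser c s%:C - v) < e.
Proof.
move=> cv e e0.
pose D n := series (c : nat -> R[i]^o) n.+1 - v.
have [B1 hB1] := cvgn_bounded cv.
pose B := B1 + modc v.
have DB n : modc (D n) <= B.
  by rewrite /D (le_trans (modcB _ _)) // lerD2r.
have B0 : 0 <= B by apply: le_trans (modc_ge0 _) (DB 0%N).
have [N hN] : exists N, forall n, (N <= n)%N -> modc (D n) < e / 2.
  have /cvgn_modcP /(_ (e / 2)) [|N hN] := cv; first by lra.
  by exists N => n Nn; apply: hN; rewrite (leq_trans Nn).
have NB : 0 <= N%:R * B by rewrite mulr_ge0 ?ler0n.
exists (e / (2 * (N%:R * B + 1))); first by rewrite divr_gt0 // mulr_gt0 //; lra.
move=> s s0 s1 sd.
have ns : modc (s%:C : R[i]) = s by rewrite modc_real ger0_norm.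
have ps : 0 < 1 - s by lra.
have hy := pserP (bounded_coef_pser s0 s1 DB) (z := s%:C).
have {}hy := hy _; rewrite ns in hy; move/(_ (lexx s)) in hy.
set y := pser D s%:C in hy.
have hc : pser c s%:C = (1 - s)%:C * y + v.
  apply: hasSum_csum.
  (* The sequence D shifted by one index: its differences with D are c. *)
  pose g n := (if n is m.+1 then D m else - v) * s%:C ^+ n.
  have hg : hasSum g (g 0%N + s%:C * y).
    apply: hasSum_succ; apply: eq_hasSum (hasSumZ s%:C hy) => n.
    by rewrite /g exprS mulrCA.
  have -> : (1 - s)%:C * y + v = y - (g 0%N + s%:C * y).
    by rewrite /g expr0 mulr1 rmorphB /= mulrBl mul1r opprD opprK; ring.
  apply: eq_hasSum (hasSumD hy (hasSumN hg)) => n.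
  rewrite /g -mulrBl; congr (_ * _); case: n => [|n].
    by rewrite /D /series /= big_nat1; ring.
  by rewrite /D /series /= [in LHS]big_nat_recr //=; ring.
rewrite hc addrK modcM modc_real ger0_norm ?(ltW ps) //.
have yM : modc y <= N%:R * B + e / 2 * (1 - s)^-1.
  apply: modc_hasSum_le hy _.
  have h1 : boundedSums (fun n => if (n < N)%N then B else 0) (N%:R * B).
    apply: boundedSums_nat => [n|n]; first by case: ifP.
    have -> : \sum_(k < n) (if (k < N)%N then B else 0) = (minn n N)%:R * B.
      elim: n => [|n IH]; first by rewrite big_ord0 min0n mul0r.
      rewrite big_ord_recr /= IH; case: ifPn => nN.
        by rewrite (minn_idPl (ltnW nN)) (minn_idPl nN) -natr1 mulrDl mul1r.
      rewrite -leqNgt in nN.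
      by rewrite (minn_idPr nN) (minn_idPr (leqW nN)) addr0.
    by rewrite ler_wpM2r // ler_nat geq_minr.
  have e2 : 0 <= e / 2 by lra.
  apply: boundedSums_le (boundedSumsD h1
    (boundedSumsZ e2 (boundedSums_geometric s0 s1))) => n.
  rewrite modcM modcX ns; have sn : 0 <= s ^+ n by rewrite exprn_ge0.
  case: ltnP => nN.
    have s1n : s ^+ n <= 1 by rewrite exprn_ile1 // ltW.
    apply: le_trans (_ : B <= _); last by rewrite lerDl mulr_ge0.
    by rewrite -[leRHS]mulr1 ler_pM ?modc_ge0.
  by rewrite add0r ler_wpM2r // ltW // hN.
apply: le_lt_trans (_ : (1 - s) * (N%:R * B + e / 2 * (1 - s)^-1) < _).
  by rewrite ler_wpM2l // ltW.
rewrite mulrDr [X in _ + X]mulrCA divff ?gt_eqF // mulr1.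
suff : (1 - s) * (N%:R * B) < e / 2 by lra.
apply: le_lt_trans (_ : (1 - s) * (N%:R * B + 1) < _).
  by rewrite ler_wpM2l ?(ltW ps) // lerDl.
rewrite -ltr_pdivlMr; last by lra.
by rewrite -mulrA -invfM; lra.
Qed.

Lemma boundedSums_small_tail (T : choiceType) (m : T -> R) M e :
  (forall x, 0 <= m x) -> boundedSums m M -> 0 < e ->
  exists J : {fset T}, boundedSums (fun x => if x \in J then 0 else m x) e.
Proof.
move=> m0 mM e0.
have [v /hasSumP /(_ (e / 2))[|J hJ]] := hasSum_ge0_bounded m0 mM; first by lra.
exists J => K.
have h1 := hJ _ (fsubset_refl J); have h2 := hJ _ (fsubsetUl J K).
have := modcB (\sum_(x <- (J `|` K)%fset) (m x)%:C - v) (\sum_(x <- J) (m x)%:C - v).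
rewrite opprB addrA subrK => h3; have := le_trans h3 (ltW (ltrD h2 h1)).
rewrite -!rmorph_sum -rmorphB modc_real -splitr; apply: le_trans.
apply: le_trans (ler_norm _).
rewrite [\sum_(x <- (J `|` K)%fset) _](big_fsetID _ (mem J)) /=.
rewrite [X in X + _ - _](_ : _ = \sum_(x <- J) m x); last first.
  by apply: eq_fbigl => x; rewrite !inE /=; case: (x \in J); rewrite ?andbF.
rewrite addrC addKr (big_fsetID _ (mem J)) /= big1_fset ?add0r => [|x]; last first.
  by rewrite !inE /= => /andP[_ ->].
rewrite le_eqVlt; apply/orP; left; apply/eqP; apply: eq_fbig => x.
  by rewrite !inE /=; case: (x \in J); rewrite ?andbF.
by rewrite !inE /= => /andP[_ /negPf ->].
Qed.

Lemma modc_exprB_le z0 r n : modc z0 <= r ->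
  exists L, 0 <= L /\
    forall z, modc z <= r -> modc (z ^+ n - z0 ^+ n) <= L * modc (z - z0).
Proof.
move=> z0r; have r0 : 0 <= r by apply: le_trans (modc_ge0 _) z0r.
elim: n => [|n [L [L0 IH]]].
  by exists 0; split=> // z' _; rewrite !expr0 subrr modc0 mul0r.
exists (r * L + modc z0 ^+ n); split=> [|z' zr'].
  by rewrite addr_ge0 ?mulr_ge0 ?exprn_ge0 ?modc_ge0.
have -> : z' ^+ n.+1 - z0 ^+ n.+1 = z' * (z' ^+ n - z0 ^+ n) + (z' - z0) * z0 ^+ n.
  by rewrite !exprS; ring.
apply: le_trans (modcD _ _) _; rewrite !modcM modcX [leRHS]mulrDl [X in _ + X]mulrC lerD2r.
by rewrite -mulrA ler_pM ?modc_ge0 // IH.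
Qed.

(** On the closed disc of absolute convergence the power series is a
    uniform limit of polynomials, boundary included. *)
Lemma pser_continuous (c : nat -> R[i]) r M z0 : modc z0 <= r ->
  boundedSums (fun n => modc (c n) * r ^+ n) M ->
  forall e, 0 < e -> exists2 d, 0 < d & forall z, modc z <= r -> modc (z - z0) < d ->
    modc (pser c z - pser c z0) < e.
Proof.
move=> z0r cM e e0; have r0 : 0 <= r by apply: le_trans (modc_ge0 _) z0r.
have m0 n : 0 <= modc (c n) * r ^+ n by rewrite mulr_ge0 ?modc_ge0 ?exprn_ge0.
have e40 : 0 < e / 4 by lra.
have [J hJ] := boundedSums_small_tail m0 cM e40.
have [L hL] := choice (fun n => modc_exprB_le n z0r).
pose S := \sum_(n <- J) modc (c n) * L n.
have S0 : 0 <= S by rewrite sumr_ge0 // => n _; rewrite mulr_ge0 ?modc_ge0 ?(hL n).1.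
exists (e / (4 * (S + 1))); first by rewrite divr_gt0 // mulr_gt0 //; lra.
move=> z zr zd.
have tail z' : modc z' <= r -> modc (pser c z' - \sum_(n <- J) c n * z' ^+ n) <= e / 4.
  move=> zr'.
  have hf := @hasSum_finite R nat J (fun n => if n \in J then c n * z' ^+ n else 0).
  have {}hf := hf (fun n nJ => ifN _ _ nJ).
  have E : \sum_(n <- J) (if n \in J then c n * z' ^+ n else 0) =
      \sum_(n <- J) c n * z' ^+ n by apply: eq_fbig => // n ->.
  rewrite E in hf.
  apply: modc_hasSum_le (hasSumD (pserP cM zr') (hasSumN hf)) _.
  apply: boundedSums_le hJ => n; case: ifP => _; first by rewrite subrr modc0.
  rewrite subr0 modcM modcX ler_wpM2l ?modc_ge0 //.
  by rewrite lerXn2r ?nnegrE ?modc_ge0.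
have h1 := tail _ zr; have h2 := tail _ z0r.
set P := \sum_(n <- J) c n * z ^+ n in h1; set P0 := \sum_(n <- J) c n * z0 ^+ n in h2.
have h3 : modc (P - P0) <= S * modc (z - z0).
  rewrite /P /P0 -sumrB mulr_suml; apply: le_trans (modc_sum _ _ _) _.
  apply: ler_sum => n _; rewrite -mulrBr modcM -mulrA ler_wpM2l ?modc_ge0 //.
  exact: (hL n).2.
have h4 : S * modc (z - z0) <= e / 4.
  apply: le_trans (_ : (S + 1) * modc (z - z0) <= _).
    by rewrite ler_wpM2r ?modc_ge0 // lerDl.
  rewrite mulrC -ler_pdivlMr; last by lra.
  by rewrite -mulrA -invfM ltW.
move: (pser c z) (pser c z0) P P0 h1 h2 h3 => X X0 P P0 h1 h2 h3.
have -> : X - X0 = (X - P) - (X0 - P0) + (P - P0) by ring.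
have := modcD (X - P - (X0 - P0)) (P - P0); have := modcB (X - P) (X0 - P0).
lra.
Qed.

End Abel.

(** * The binomial series and the logarithmic series *)

Section Binomial.
Variable R : realType.
Implicit Types (l m z h : R[i]) (r q x y : R).

Lemma pochnS l n : pochn l n.+1 = pochn l n * (l + n%:R).
Proof. by rewrite /pochn big_ord_recr. Qed.

Lemma pochn0 l : pochn l 0 = 1.
Proof. by rewrite /pochn big_ord0. Qed.

Lemma pochnD l n k : pochn l (n + k) = pochn l n * pochn (l + n%:R) k.
Proof.
elim: k => [|k IH]; first by rewrite addn0 pochn0 mulr1.
by rewrite addnS !pochnS IH -mulrA natrD addrA.
Qed.

(** The coefficient (l)_n / n! of z^n in (1 - z)^(- l). *)
Definition binc l n : R[i] := pochn l n / n`!%:R.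

Lemma natC_neq0 n : (0 < n)%N -> (n%:R : R[i]) != 0.
Proof. by rewrite pnatr_eq0 -lt0n. Qed.

Lemma binc0 l : binc l 0 = 1.
Proof. by rewrite /binc pochn0 fact0 divr1. Qed.

Lemma bincS l n : n.+1%:R * binc l n.+1 = (l + n%:R) * binc l n.
Proof.
have h1 := natC_neq0 (ltn0Sn n); have h2 := natC_neq0 (fact_gt0 n).
rewrite /binc pochnS factS natrM; field.
by rewrite h2 addrC natr1 h1.
Qed.

(** Both sides satisfy (n + 1) S_(n+1) = (l + m + n) S_n: on the right, write
    n + 1 = i + (n + 1 - i) and absorb each factor into one coefficient. *)
Lemma binc_vandermonde l m n :
  binc (l + m) n = \sum_(i < n.+1) binc l i * binc m (n - i)%N.
Proof.
elim: n => [|n IH]; first by rewrite big_ord1 !binc0 mulr1.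
apply: (mulfI (natC_neq0 (ltn0Sn n))); rewrite bincS IH.
pose F i := binc l i * binc m (n - i)%N.
have -> : n.+1%:R * \sum_(i < n.+2) binc l i * binc m (n.+1 - i)%N =
  \sum_(i < n.+2) (i%:R * binc l i) * binc m (n.+1 - i)%N +
  \sum_(i < n.+2) binc l i * ((n.+1 - i)%:R * binc m (n.+1 - i)%N).
  rewrite mulr_sumr -big_split /=; apply: eq_bigr => i _.
  have -> : n.+1%:R = i%:R + (n.+1 - i)%:R :> R[i].
    by rewrite -natrD subnKC // -ltnS.
  ring.
rewrite [X in _ = X + _]big_ord_recl /= !mul0r add0r.
rewrite [X in _ = _ + X]big_ord_recr /= subnn mul0r mulr0 addr0.
rewrite mulr_sumr -big_split /=; apply: eq_bigr => i _.
have iN : (i <= n)%N by rewrite -ltnS.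
rewrite /bump /= add1n subSS bincS (subSn iN) bincS.
have -> : n%:R = i%:R + (n - i)%:R :> R[i] by rewrite -natrD subnKC // -ltnS.
ring.
Qed.

Lemma binc1 n : binc 1 n = 1.
Proof.
elim: n => [|n IH]; first exact: binc0.
apply: (mulfI (natC_neq0 (ltn0Sn n))); rewrite bincS IH.
by rewrite addrC natr1.
Qed.

Lemma binc0S n : binc 0 n.+1 = 0.
Proof. by rewrite /binc /pochn big_ord_recl /= addr0 !mul0r. Qed.

Lemma binc_vandermonde_exp l m n z : binc (l + m) n * z ^+ n =
  \sum_(i < n.+1) (binc l i * z ^+ i) * (binc m (n - i)%N * z ^+ (n - i)).
Proof.
rewrite binc_vandermonde mulr_suml; apply: eq_bigr => i _.
by rewrite [RHS]mulrACA -exprD subnKC // -ltnS.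
Qed.

Lemma modc_term (c : nat -> R[i]) q n : 0 <= q ->
  modc (c n * q%:C ^+ n) = modc (c n) * q ^+ n.
Proof. by move=> q0; rewrite modcM modcX modc_real ger0_norm. Qed.

Lemma binc_bounded_add l m q M N : 0 <= q ->
  boundedSums (fun n => modc (binc l n) * q ^+ n) M ->
  boundedSums (fun n => modc (binc m n) * q ^+ n) N ->
  boundedSums (fun n => modc (binc (l + m) n) * q ^+ n) (M * N).
Proof.
move=> q0 hM hN.
have {}hM : boundedSums (fun n => modc (binc l n * q%:C ^+ n)) M.
  by apply: boundedSums_le hM => n; rewrite modc_term.
have {}hN : boundedSums (fun n => modc (binc m n * q%:C ^+ n)) N.
  by apply: boundedSums_le hN => n; rewrite modc_term.
have [_] := hasSum_cauchy hM hN (csumP hM) (csumP hN).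
by apply: boundedSums_le => n; rewrite -modc_term // binc_vandermonde_exp.
Qed.

(** Raising the parameter by one multiplies the series by 1 / (1 - z), hence the
    bound by 1 / (1 - q). *)
Lemma binc_bounded_addn l n q M : 0 <= q -> q < 1 ->
  boundedSums (fun j => modc (binc l j) * q ^+ j) M ->
  boundedSums (fun j => modc (binc (l + n%:R) j) * q ^+ j) (M * (1 - q)^-1 ^+ n).
Proof.
move=> q0 q1 hM; elim: n => [|n IH]; first by rewrite addr0 mulr1.
rewrite -natr1 addrA exprSr mulrA; apply: (binc_bounded_add q0 IH).
apply: boundedSums_le (boundedSums_geometric q0 q1) => j.
by rewrite binc1 modc1 mul1r.
Qed.

Lemma binc0_bounded q : 0 <= q ->
  boundedSums (fun j => modc (binc 0 j) * q ^+ j) 1.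
Proof.
move=> q0; apply: boundedSums_nat => [n|n].
  by rewrite mulr_ge0 ?modc_ge0 ?exprn_ge0.
case: n => [|n]; first by rewrite big_ord0.
rewrite big_ord_recl /= binc0 modc1 expr0 mulr1 big1 ?addr0 // => i _.
by rewrite binc0S modc0 mul0r.
Qed.

Lemma modc_binc_le l r n : modc l <= r -> modc (binc l n) <= modc (binc r%:C n).
Proof.
move=> lr; have r0 : 0 <= r by apply: le_trans (modc_ge0 _) lr.
elim: n => [|n IH]; first by rewrite !binc0.
have n0 : 0 < (n.+1%:R : R) by rewrite ltr0n.
rewrite -(ler_pM2l n0) -(@modc_nat R n.+1) -!modcM !bincS (modcM (l + _)) (modcM (r%:C + _)).
rewrite ler_pM ?modc_ge0 //.
have -> : r%:C + n%:R = (r + n%:R)%:C :> R[i].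
  by rewrite rmorphD /= (rmorph_nat (real_complex R)).
rewrite modc_real ger0_norm ?addr_ge0 ?ler0n //.
by rewrite (le_trans (modcD _ _)) // modc_nat lerD2r.
Qed.

(** The coefficients for l are dominated by those for a natural number above
    |l|, for which the series is a power of the geometric series. *)
Lemma binc_bounded l q : 0 <= q -> q < 1 ->
  exists M, boundedSums (fun j => modc (binc l j) * q ^+ j) M.
Proof.
move=> q0 q1; pose n := (Num.truncn (modc l)).+1.
have ln : modc l <= n%:R by rewrite ltW // truncnS_gt.
exists (1 * (1 - q)^-1 ^+ n).
have := binc_bounded_addn n q0 q1 (binc0_bounded q0); rewrite add0r.
apply: boundedSums_le => j; rewrite ler_wpM2r ?exprn_ge0 //.
by have := modc_binc_le j ln; rewrite (rmorph_nat (real_complex R)).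
Qed.

Definition binser l z := pser (binc l) z.

Lemma binserP l z : modc z < 1 -> hasSum (fun j => binc l j * z ^+ j) (binser l z).
Proof.
move=> z1; have [M hM] := binc_bounded l (modc_ge0 z) z1.
exact: pserP hM (lexx _).
Qed.

Lemma binserD l m z : modc z < 1 -> binser (l + m) z = binser l z * binser m z.
Proof.
move=> z1; apply: hasSum_csum.
have b l' : exists M, boundedSums (fun j => modc (binc l' j * z ^+ j)) M.
  have [M hM] := binc_bounded l' (modc_ge0 z) z1; exists M.
  by apply: boundedSums_le hM => j; rewrite modcM modcX.
have [M hM] := b l; have [N hN] := b m.
have [h _] := hasSum_cauchy hM hN (binserP l z1) (binserP m z1).
by apply: eq_hasSum h => n; rewrite binc_vandermonde_exp.
Qed.

Lemma binser0 z : modc z < 1 -> binser 0 z = 1.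
Proof.
move=> z1; apply: hasSum_csum.
have := hasSum_succ (f := fun j => binc 0 j * z ^+ j) (v := 0).
rewrite binc0 mulr1 addr0; apply.
by apply: eq_hasSum (hasSum0 R nat) => n; rewrite binc0S mul0r.
Qed.

Lemma binser1 z : modc z < 1 -> binser 1 z = (1 - z)^-1.
Proof.
move=> z1; apply: hasSum_csum.
by apply: eq_hasSum (hasSum_geometric z1) => n; rewrite binc1 mul1r.
Qed.

Lemma one_sub_neq0 z : modc z < 1 -> 1 - z != 0.
Proof. by rewrite subr_eq0; apply: contraTneq => <-; rewrite modc1 ltxx. Qed.

Lemma binserN1 z : modc z < 1 -> binser (-1) z = 1 - z.
Proof.
move=> z1; apply: (mulIf (invr_neq0 (one_sub_neq0 z1))).
by rewrite divff ?one_sub_neq0 // -binser1 // -binserD // addNr binser0.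
Qed.

Lemma binser_natM n l z : modc z < 1 -> binser (n%:R * l) z = binser l z ^+ n.
Proof.
move=> z1; elim: n => [|n IH]; first by rewrite mul0r binser0.
by rewrite -natr1 mulrDl mul1r binserD // IH exprSr.
Qed.

Lemma binser_addn n l z : modc z < 1 ->
  binser (l + n%:R) z = binser l z * (1 - z)^-1 ^+ n.
Proof. by move=> z1; rewrite (binserD _ _ z1) -[n%:R]mulr1 (binser_natM _ _ z1) binser1. Qed.

(** The series of - log(1 - z); its constant term is right because 0^-1 = 0. *)
Definition logser z := pser (fun j => j%:R^-1) z.

Lemma logser_bounded q : 0 <= q -> q < 1 ->
  boundedSums (fun j => modc (j%:R^-1 : R[i]) * q ^+ j) (1 - q)^-1.
Proof.
move=> q0 q1; apply: boundedSums_le (boundedSums_geometric q0 q1) => j.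
rewrite ler_piMl ?exprn_ge0 // modcV modc_nat.
by case: j => [|j]; rewrite ?invr0 // invf_le1 ?ltr0n // ler1n.
Qed.

Lemma logserP z : modc z < 1 -> hasSum (fun j => j%:R^-1 * z ^+ j) (logser z).
Proof. by move=> z1; apply: pserP (logser_bounded (modc_ge0 z) z1) (lexx _). Qed.

(** First-order expansion in the exponent h, at fixed z.  For j >= 1 the coefficient
    of z^j is h / j times the product of the 1 + h / i for 0 < i < j, and that
    product differs from 1 by at most |h| (j - 1). *)
Lemma binser_expansion h z : modc z < 1 -> modc h <= 1 ->
  modc (binser h z - 1 - h * logser z) <= modc h ^+ 2 * (1 - modc z)^-1.
Proof.
move=> z1 h1.
have key j : modc (j.+1%:R * binc h j.+1 - h) <= modc h ^+ 2 * j%:R.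
  elim: j => [|j IH]; first by rewrite bincS binc0 mulr1 addr0 subrr modc0 mulr0.
  have j0 := natC_neq0 (ltn0Sn j).
  have -> : j.+2%:R * binc h j.+2 - h =
      (j.+1%:R * binc h j.+1 - h) * (1 + h / j.+1%:R) + h ^+ 2 / j.+1%:R.
    by rewrite bincS; field; rewrite addrC natr1.
  apply: le_trans (modcD _ _) _; rewrite modcM modcf modcX modc_nat.
  have jr : 0 < (j.+1%:R : R) by rewrite ltr0n.
  have h2 : modc (1 + h / j.+1%:R) <= 1 + j.+1%:R^-1.
    apply: le_trans (modcD _ _) _; rewrite modc1 lerD2l modcf modc_nat.
    by rewrite ler_pdivrMr // mulVf // gt_eqF.
  apply: le_trans (_ : modc h ^+ 2 * j%:R * (1 + j.+1%:R^-1) +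
    modc h ^+ 2 / j.+1%:R <= _).
    by rewrite lerD2r ler_pM ?modc_ge0.
  rewrite le_eqVlt; apply/orP; left; apply/eqP.
  rewrite -[j.+1%:R]natr1; field.
  by rewrite natr1 gt_eqF.
have b := boundedSumsZ (exprn_ge0 2 (modc_ge0 h))
  (boundedSums_geometric (modc_ge0 z) z1).
have h1z := hasSum_single 0%N (1 : R[i]).
have hs := hasSumD (hasSumD (binserP h z1) (hasSumN h1z))
  (hasSumN (hasSumZ h (logserP z1))).
apply: modc_hasSum_le hs _; apply: boundedSums_le b => j.
case: j => [|j] /=.
  by rewrite binc0 mulr1 subrr invr0 mul0r mulr0 subr0 modc0 mulr_ge0 ?sqr_ge0.
have j0 := natC_neq0 (ltn0Sn j).
have -> : binc h j.+1 * z ^+ j.+1 - 0 - h * (j.+1%:R^-1 * z ^+ j.+1) =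
    (j.+1%:R * binc h j.+1 - h) * j.+1%:R^-1 * z ^+ j.+1.
  by rewrite subr0; field; rewrite addrC natr1.
rewrite 2!modcM modcX modcV modc_nat ler_wpM2r ?exprn_ge0 ?modc_ge0 //.
rewrite ler_pdivrMr ?ltr0n //; apply: le_trans (key j) _.
by rewrite ler_wpM2l ?sqr_ge0 // ler_nat.
Qed.

End Binomial.

(** * The complex exponential and principal powers *)

Section ComplexExponential.
Variable R : realType.
Implicit Types (l z w h : R[i]) (x y r : R).

Lemma cexpD z w : cexp (z + w) = cexp z * cexp w.
Proof.
case: z => a b; case: w => c d; rewrite /cexp /= expRD cosD sinD.
by apply/eqP; rewrite eq_complex /=; apply/andP; split; apply/eqP; ring.
Qed.

Lemma cexp0 : cexp 0 = 1 :> R[i].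
Proof. by rewrite /cexp /= expR0 cos0 sin0 mulr1 mulr0. Qed.

Lemma cexp_natM n z : cexp (n%:R * z) = cexp z ^+ n.
Proof.
elim: n => [|n IH]; first by rewrite mul0r cexp0.
by rewrite -natr1 mulrDl mul1r cexpD IH exprSr.
Qed.

Lemma modc_cexp z : modc (cexp z) = expR (complex.Re z).
Proof.
by rewrite /cexp /= !exprMn -mulrDr cos2Dsin2 mulr1 sqrtr_sqr ger0_norm ?expR_ge0.
Qed.

Lemma ImN z : complex.Im (- z) = - complex.Im z.
Proof. by case: z. Qed.

Lemma ReB z w : complex.Re (z - w) = complex.Re z - complex.Re w.
Proof. by case: z; case: w. Qed.

Lemma ImB z w : complex.Im (z - w) = complex.Im z - complex.Im w.
Proof. by case: z; case: w. Qed.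

Lemma Re_cexp z : complex.Re (cexp z) = expR (complex.Re z) * cos (complex.Im z).
Proof. by []. Qed.

Lemma expR_quadratic x : `|x| <= 2^-1 -> `|expR x - 1 - x| <= 2 * x ^+ 2.
Proof.
rewrite ler_norml => /andP[x1 x2].
have h1 := expR_ge1Dx x; have h2 := expR_ge1Dx (- x).
have e0 := expR_gt0 x.
have h3 : expR x * (1 - x) <= 1.
  by have := ler_wpM2l (ltW e0) h2; rewrite expRxMexpNx_1.
rewrite ger0_norm; last by lra.
nra.
Qed.

Lemma sin_mean_value x : exists2 c, `|c| <= `|x| & sin x = cos c * x.
Proof.
have mv y : 0 <= y -> exists2 c, `|c| <= `|y| & sin y = cos c * y.
  move=> y0.
  have sc : {within `[0, y]%classic, continuous (@sin R)}.
    by apply: continuous_subspaceT => a; exact: continuous_sin.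
  have [c cy h] := MVT_segment y0 (fun a _ => is_derive_sin a) sc.
  move: cy; rewrite in_itv /= => /andP[c0 cy].
  by exists c; [rewrite !ger0_norm|move: h; rewrite sin0 !subr0].
case: (leP 0 x) => [|x0]; first exact: mv.
have [|c cx h] := mv (- x); first by lra.
exists c; first by rewrite normrN in cx.
by apply: oppr_inj; rewrite -sinN h mulrN.
Qed.

Lemma sin_abs_le x : `|sin x| <= `|x|.
Proof.
have [c _ ->] := sin_mean_value x.
by rewrite normrM ler_piMl // cos_max.
Qed.

Lemma cos_quadratic x : 0 <= 1 - cos x <= x ^+ 2 / 2.
Proof.
have -> : cos x = 1 - 2 * sin (x / 2) ^+ 2.
  have -> : x = (x / 2) *+ 2 by rewrite -mulr_natr divfK.
  rewrite cos_mulr2n; rewrite -[(x / 2) *+ 2]mulr_natr divfK //.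
  by have := cos2Dsin2 (x / 2); lra.
have h := sin_abs_le (x / 2).
have h2 : sin (x / 2) ^+ 2 <= (x / 2) ^+ 2.
  by rewrite -[leLHS]real_normK ?num_real // -[leRHS]real_normK ?num_real // lerXn2r ?nnegrE.
have s0 := sqr_ge0 (sin (x / 2)).
have -> : x ^+ 2 / 2 = 2 * (x / 2) ^+ 2 by field.
by apply/andP; split; lra.
Qed.

Lemma sin_quadratic x : `|x| <= 1 -> `|sin x - x| <= x ^+ 2.
Proof.
move=> x1; have [c cx ->] := sin_mean_value x.
have -> : cos c * x - x = - ((1 - cos c) * x) by ring.
have /andP[c0 c1] := cos_quadratic c.
rewrite normrN normrM (ger0_norm c0).
have c2 : c ^+ 2 <= x ^+ 2.
  by rewrite -[leLHS]real_normK ?num_real // -[leRHS]real_normK ?num_real // lerXn2r ?nnegrE.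
have x2 := sqr_ge0 x.
apply: le_trans (_ : (1 - cos c) * 1 <= _); first by rewrite ler_wpM2l.
lra.
Qed.

Lemma cexp_expansion z : modc z <= 2^-1 -> modc (cexp z - 1 - z) <= 4 * modc z ^+ 2.
Proof.
move=> z1; have hx := le_trans (modc_Re z) z1; have hy := le_trans (modc_Im z) z1.
apply: le_trans (modc_ReIm _) _; rewrite modc_sqr.
case: z {z1} hx hy => x y /= hx hy; rewrite !oppr0.
have h1 := expR_quadratic hx.
have /andP[c0 c1] := cos_quadratic y.
have h2 : `|sin y - y| <= y ^+ 2 by apply: sin_quadratic; lra.
have cm := cos_max y.
set E := expR x in h1 *; set C := cos y in c0 c1 cm *; set S := sin y in h2 *.
have x2 := sqr_ge0 x; have y2 := sqr_ge0 y.
have xx : `|x| ^+ 2 = x ^+ 2 by rewrite real_normK ?num_real.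
have yy : `|y| ^+ 2 = y ^+ 2 by rewrite real_normK ?num_real.
have nx := normr_ge0 x; have ny := normr_ge0 y.
have re : `|E * C - 1 - x| <= 2 * x ^+ 2 + y ^+ 2.
  have -> : E * C - 1 - x = (E - 1 - x) * C - (1 + x) * (1 - C) by ring.
  apply: le_trans (ler_normB _ _) _; rewrite !normrM (ger0_norm c0).
  have a1 : `|E - 1 - x| * `|C| <= 2 * x ^+ 2.
    by rewrite -[leRHS]mulr1 ler_pM.
  have a2 : `|1 + x| <= 2 by apply: le_trans (ler_normD _ _) _; rewrite normr1; lra.
  have a3 : `|1 + x| * (1 - C) <= 2 * (y ^+ 2 / 2) by rewrite ler_pM.
  lra.
have im : `|E * S - y| <= x ^+ 2 + 3 * y ^+ 2.
  have E2 : `|E| <= 2.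
    have -> : E = (E - 1 - x) + (1 + x) by ring.
    apply: le_trans (ler_normD _ _) _.
    have a2 : `|1 + x| <= 3 / 2 by apply: le_trans (ler_normD _ _) _; rewrite normr1; lra.
    suff : 2 * x ^+ 2 <= 1 / 2 by lra.
    by rewrite -xx; nra.
  have E1 : `|E - 1| <= 2 * `|x|.
    have -> : E - 1 = (E - 1 - x) + x by ring.
    apply: le_trans (ler_normD _ _) _.
    suff : 2 * x ^+ 2 <= `|x| by lra.
    by rewrite -xx; nra.
  have -> : E * S - y = E * (S - y) + (E - 1) * y by ring.
  apply: le_trans (ler_normD _ _) _; rewrite !normrM.
  have a1 : `|E| * `|S - y| <= 2 * y ^+ 2 by rewrite ler_pM.
  have a2 : `|E - 1| * `|y| <= 2 * `|x| * `|y| by rewrite ler_pM.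
  have a3 := sqr_ge0 (`|x| - `|y|).
  rewrite -xx; rewrite -yy in a1 *; nra.
rewrite addr0; lra.
Qed.

Lemma modc_exprB z w M n : 1 <= M -> modc z <= M -> modc w <= M ->
  modc (z ^+ n - w ^+ n) <= n%:R * M ^+ n * modc (z - w).
Proof.
move=> M1 zM wM; have M0 : 0 <= M by lra.
elim: n => [|n IH]; first by rewrite !expr0 subrr modc0 !mul0r.
have -> : z ^+ n.+1 - w ^+ n.+1 = z * (z ^+ n - w ^+ n) + (z - w) * w ^+ n.
  by rewrite !exprS; ring.
apply: le_trans (modcD _ _) _; rewrite !modcM modcX -natr1 !mulrDl mul1r.
apply: lerD.
  rewrite exprS mulrCA -mulrA -mulrA; apply: ler_pM; rewrite ?modc_ge0 //.
  by rewrite mulrA.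
rewrite mulrC ler_wpM2r ?modc_ge0 //.
apply: le_trans (_ : M ^+ n <= _); first by rewrite lerXn2r ?nnegrE ?modc_ge0.
by rewrite exprS ler_peMl ?exprn_ge0.
Qed.

(** As functions of l both sides turn sums into products, and both are
    1 + h L + O(h^2) at h = l / n.  Their n-th powers therefore differ by O(1/n). *)
Lemma binser_cexp l z : modc z < 1 -> binser l z = cexp (l * logser z).
Proof.
move=> z1; set L := logser z.
pose a := modc l; pose b := modc L; pose c := (1 - modc z)^-1.
have a0 : 0 <= a := modc_ge0 _. have b0 : 0 <= b := modc_ge0 _.
have c0 : 0 <= c by rewrite invr_ge0; lra.
pose K2 := a * b + c * a; pose K1 := (c + 4 * b ^+ 2) * a ^+ 2.
have K20 : 0 <= K2 by rewrite addr_ge0 ?mulr_ge0.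
have K10 : 0 <= K1.
  by apply: mulr_ge0; rewrite ?sqr_ge0 // addr_ge0 // mulr_ge0 ?sqr_ge0.
(* At h = l / n both functions have modulus at most exp (K2 / n), and they differ
   by at most K1 / n^2; the lower bound on n makes h and h L small enough for the
   two expansions. *)
have step n : (0 < n)%N -> a + 2 * (a * b) <= n%:R ->
    modc (binser l z - cexp (l * L)) <= expR K2 * K1 / n%:R.
  move=> n0 hn; have nr : 0 < (n%:R : R) by rewrite ltr0n.
  have nn : (n%:R : R[i]) != 0 by rewrite pnatr_eq0 -lt0n.
  pose h := l / n%:R.
  have lh : l = n%:R * h by rewrite /h mulrCA divff ?mulr1.
  have mh : modc h = a / n%:R by rewrite modcf modc_nat.
  have mh1 : modc h <= 1.
    by rewrite mh ler_pdivrMr // mul1r; have := mulr_ge0 a0 b0; lra.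
  have mhL : modc (h * L) <= 2^-1.
    by rewrite modcM mh mulrAC ler_pdivrMr // -/b; lra.
  have e1 := binser_expansion z1 mh1; have e2 := cexp_expansion mhL.
  rewrite -/c -/L in e1.
  set P := binser h z in e1 *; set X := cexp (h * L) in e2 *.
  have d : modc (P - X) <= K1 / n%:R ^+ 2.
    have -> : P - X = (P - 1 - h * L) - (X - 1 - h * L) by ring.
    apply: le_trans (modcB _ _) (le_trans (lerD e1 e2) _).
    rewrite modcM -/b mh le_eqVlt; apply/orP; left; apply/eqP.
    by rewrite /K1; field; rewrite gt_eqF.
  have M1 : 1 <= expR (K2 / n%:R).
    by apply: le_trans (expR_ge1Dx _); rewrite lerDl divr_ge0 // ltW.
  have PM : modc P <= expR (K2 / n%:R).
    apply: le_trans (expR_ge1Dx _).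
    have -> : P = (P - 1 - h * L) + (1 + h * L) by ring.
    apply: le_trans (modcD _ _) _; apply: le_trans (lerD e1 (modcD _ _)) _.
    rewrite modc1 modcM -/b.
    have : modc h ^+ 2 * c <= modc h * c.
      by rewrite ler_wpM2r // expr2 ler_piMl // modc_ge0.
    have -> : K2 / n%:R = modc h * b + modc h * c.
      by rewrite mh /K2; field; rewrite gt_eqF.
    lra.
  have XM : modc X <= expR (K2 / n%:R).
    rewrite modc_cexp ler_expR; apply: le_trans (ler_norm _) _.
    apply: le_trans (modc_Re _) _; rewrite modcM mh -/b mulrAC.
    rewrite ler_wpM2r ?invr_ge0 ?(ltW nr) // lerDl mulr_ge0 //.
  rewrite lh -mulrA binser_natM // cexp_natM -/P -/X.
  apply: le_trans (modc_exprB n M1 PM XM) _.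
  rewrite -expRM_natl mulrCA divff ?gt_eqF // mulr1.
  apply: le_trans (_ : n%:R * expR K2 * (K1 / n%:R ^+ 2) <= _).
    by rewrite ler_wpM2l // mulr_ge0 ?expR_ge0 // ltW.
  rewrite le_eqVlt; apply/orP; left; apply/eqP; field.
  by rewrite gt_eqF.
apply/eqP; rewrite -subr_eq0; apply/eqP; apply: modc_lim_eq0 => e e0.
pose t := expR K2 * K1.
have t0 : 0 <= t by rewrite mulr_ge0 ?expR_ge0.
have te : 0 <= t / e by rewrite divr_ge0 // ltW.
have s0 : 0 <= a + 2 * (a * b) by rewrite addr_ge0 ?mulr_ge0.
pose n := (Num.truncn (t / e + (a + 2 * (a * b)))).+1.
have hn : t / e + (a + 2 * (a * b)) <= n%:R by rewrite ltW // truncnS_gt.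
have nr : 0 < (n%:R : R) by rewrite ltr0n.
apply: le_trans (step n isT _) _; first by lra.
by rewrite -/t ler_pdivrMr // mulrC -ler_pdivrMr //; lra.
Qed.

(** The case l = -1 of the preceding lemma: the binomial series then is 1 - z. *)
Lemma cexp_logser z : modc z < 1 -> cexp (- logser z) = 1 - z.
Proof. by move=> z1; rewrite -mulN1r -binser_cexp // binserN1. Qed.

Lemma logser_scale_continuous z : modc z < 1 ->
  {within `[0, 1]%classic, continuous (fun s : R => complex.Im (logser (s%:C * z)))}.
Proof.
move=> z1; apply/subspace_continuousP => s /=; rewrite in_itv /= => /andP[s0 s1].
apply/cvgrPdist_lt => e e0.
have scale y : 0 <= y -> y <= 1 -> modc (y%:C * z) <= modc z.
  by move=> y0 y1; rewrite modcM modc_real ger0_norm // ler_piMl ?modc_ge0.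
have [d d0 hd] := pser_continuous (scale _ s0 s1)
  (logser_bounded (modc_ge0 z) z1) e0.
have : nbhs s (ball s d) by exact: nbhsx_ballx.
rewrite /within /=; apply: filterS => y sy /=; rewrite in_itv /= => /andP[y0 y1].
apply: le_lt_trans (hd (y%:C * z) (scale _ y0 y1) _).
  rewrite modc_subC.
  have := modc_Im (logser (s%:C * z) - logser (y%:C * z)).
  by rewrite ImB.
rewrite -mulrBl -rmorphB modcM modc_real distrC.
by apply: le_lt_trans sy; rewrite ler_piMr // ltW.
Qed.

Lemma cos_zero_between x : pi / 2 <= `|x| ->
  exists v, cos v = 0 /\ Num.min 0 x <= v <= Num.max 0 x.
Proof.
have pi0 := pi_gt0 R; case: (leP 0 x) => x0.
  rewrite ger0_norm // => hx; exists (pi / 2); split; first exact: cos_pihalf.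
  by apply/andP; split; lra.
rewrite ltr0_norm // => hx; exists (- (pi / 2)).
split; first by rewrite cosN cos_pihalf.
by apply/andP; split; lra.
Qed.

(** Along the segment from 0 to z the imaginary part of the series starts at 0 and is
    continuous.  It cannot reach a zero of the cosine, since the real part of
    1 - s z stays positive. *)
Lemma Im_logser z : modc z < 1 -> `|complex.Im (logser z)| < pi / 2.
Proof.
move=> z1; rewrite ltNge; apply/negP => hpi.
pose phi (s : R) := complex.Im (logser (s%:C * z)).
have phi0 : phi 0 = 0.
  rewrite /phi mul0r /logser.
  suff -> : pser (fun j => j%:R^-1) (0 : R[i]) = 0 by [].
  apply: hasSum_csum; apply: eq_hasSum (hasSum0 R nat) => -[|j].
    by rewrite invr0 mul0r.
  by rewrite expr0n mulr0.
have phi1 : phi 1 = complex.Im (logser z) by rewrite /phi mul1r.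
have [v [v1 v2]] := cos_zero_between hpi.
rewrite -phi0 -phi1 in v2.
have [s] := IVT ler01 (logser_scale_continuous z1) v2.
rewrite in_itv /= => /andP[s0 s1] phis.
have sz : modc (s%:C * z) <= modc z.
  by rewrite modcM modc_real (ger0_norm s0) (ler_piMl (modc_ge0 z) s1).
have sz1 := le_lt_trans sz z1.
have := congr1 (@complex.Re R) (cexp_logser sz1).
rewrite Re_cexp ImN cosN phis v1 mulr0 ReB -[complex.Re 1]/1.
move/eqP; rewrite eq_sym subr_eq0 => /eqP h.
have := lt_le_trans (le_lt_trans (modc_Re (s%:C * z)) sz1) (ler_norm 1).
by rewrite -h normr1 ltxx.
Qed.

Lemma clog_cexp w : `|complex.Im w| < pi -> clog (cexp w) = w.
Proof.
move=> hw; rewrite /clog modc_cexp expRK /carg modc_cexp.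
case: w hw => x y /= ; rewrite ltr_norml => /andP[y1 y2].
have e0 := expR_gt0 x.
rewrite mulrAC divff ?gt_eqF // mul1r pmulr_rge0 //.
case: (leP 0 y) => y0.
  rewrite sin_ge0_pi ?y0 ?(ltW y2) // cosK // in_itv /= y0 ltW //.
have sy : sin y < 0.
  by rewrite -oppr_gt0 -sinN sin_gt0_pi //; apply/andP; split; lra.
rewrite leNgt sy /= cosKN ?opprK //.
by apply/andP; split; lra.
Qed.

Lemma cexp_clog z : z != 0 -> cexp (clog z) = z.
Proof.
move=> z0; have m0 : 0 < modc z by rewrite modc_gt0.
rewrite /cexp /clog /= lnK ?posrE //.
have hR : -1 <= complex.Re z / modc z <= 1.
  rewrite -ler_norml normrM normfV (ger0_norm (modc_ge0 z)).
  by rewrite ler_pdivrMr // mul1r modc_Re.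
have hc : cos (carg z) = complex.Re z / modc z.
  by rewrite /carg; case: ifP => _; rewrite ?cosN acosK // in_itv.
have sE : 1 - (complex.Re z / modc z) ^+ 2 = (complex.Im z / modc z) ^+ 2.
  rewrite !expr_div_n; apply: (mulIf (x := modc z ^+ 2)).
    by rewrite expf_neq0 // gt_eqF.
  rewrite mulrBl !divfK ?expf_neq0 ?gt_eqF // mul1r modc_sqr; ring.
have hs : sin (carg z) = complex.Im z / modc z.
  rewrite /carg; case: leP => i0; rewrite ?sinN sin_acos // sE sqrtr_sqr.
    by rewrite ger0_norm // divr_ge0 // ltW.
  by rewrite ltr0_norm ?opprK // pmulr_llt0 // invr_gt0.
rewrite hc hs; case: z m0 {hR hc hs sE z0} => x y /= m0.
by rewrite !(mulrC _ (_ / _)) !divfK ?gt_eqF.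
Qed.

Lemma cpow_nat z n : z != 0 -> cpow z (n%:R)%:C = z ^+ n.
Proof.
move=> z0; rewrite /cpow (negPf z0) (rmorph_nat (real_complex R)) cexp_natM.
by rewrite cexp_clog.
Qed.

(** The binomial theorem for the principal power. *)
Lemma binser_cpow l z : modc z < 1 -> binser l z = cpow (1 - z) (- l).
Proof.
move=> z1; rewrite /cpow (negPf (one_sub_neq0 z1)) -(cexp_logser z1).
rewrite clog_cexp; first by rewrite mulrNN binser_cexp.
rewrite ImN normrN.
by apply: lt_trans (Im_logser z1) _; have := pi_gt0 R; lra.
Qed.

End ComplexExponential.

(** * The analytic identity *)

Section Continuation.
Variable R : realType.
Implicit Types (z l t : R[i]) (d M r x s : R).

Lemma modc_one_sub_le2 t : modc t < 1 -> modc (1 - t) <= 2.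
Proof. by move=> t1; apply: le_trans (modcB _ _) _; rewrite modc1; lra. Qed.

(** The argument w(z) at which the power series G of the multiple series is
    evaluated; z = 1 gives - t / (1 - t). *)
Definition moebius t z : R[i] := - t * z * (1 - t * z)^-1.

(** The point 1/x is farther from t than 1 is.  The difference of the squares of
    the two moduli is (1 - x) (1 + x - 2 x Re t), at least (1 - x)^2, and the
    sum of the moduli is at most 4. *)
Lemma moebius_gap t x s : modc t < 1 -> 0 <= x <= s -> s < 1 ->
  x * modc (1 - t) + (1 - s) ^+ 2 / 4 <= modc (1 - t * x%:C).
Proof.
move=> t1 /andP[x0 xs] s1.
set a := modc (1 - t * x%:C); set b := x * modc (1 - t).
have a0 : 0 <= a := modc_ge0 _.
have b0 : 0 <= b by rewrite mulr_ge0 ?modc_ge0.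
have tu : complex.Re t <= 1 by have := modc_Re t; have := ler_norm (complex.Re t); lra.
have ab : (1 - x) ^+ 2 <= a ^+ 2 - b ^+ 2.
  have -> : a ^+ 2 - b ^+ 2 = (1 - x) * (1 + x - 2 * x * complex.Re t).
    rewrite /a /b exprMn !modc_sqr; case: (t) => u v /=; ring.
  have x1 : 0 <= 1 - x by lra.
  by rewrite expr2 ler_wpM2l //; have := ler_wpM2l x0 tu; lra.
have tx : modc (t * x%:C) <= x.
  by rewrite modcM modc_real ger0_norm // ler_piMl // ltW.
have a2 : a <= 2 by apply: le_trans (modcB _ _) _; rewrite modc1; lra.
have b2 : b <= 2.
  have := modc_one_sub_le2 t1.
  by rewrite /b; have := modc_ge0 (1 - t); nra.
have sx : (1 - s) ^+ 2 <= (1 - x) ^+ 2 by rewrite lerXn2r ?nnegrE; lra.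
have p2 : 0 < (1 - s) ^+ 2 by rewrite exprn_gt0 //; lra.
suff : (1 - s) ^+ 2 <= 4 * (a - b) by lra.
apply: (le_trans (le_trans sx ab)); rewrite subr_sqr.
have ba : 0 <= a - b.
  rewrite leNgt; apply/negP => h.
  have : (a - b) * (a + b) <= 0 by rewrite mulr_le0_ge0 //; lra.
  by rewrite -subr_sqr; lra.
by rewrite mulrC ler_wpM2r //; lra.
Qed.

Lemma moebius_le t x : modc t < 1 -> 0 <= x <= 1 ->
  modc (moebius t x%:C) <= modc (moebius t 1).
Proof.
move=> t1 /andP[x0 x1].
have p1 : 0 < modc (1 - t) by rewrite modc_gt0 one_sub_neq0.
have le1 : x * modc (1 - t) <= modc (1 - t * x%:C).
  move: x1; rewrite le_eqVlt => /predU1P[->|x1]; first by rewrite mul1r mulr1.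
  have := @moebius_gap t x x t1 _ x1; rewrite x0 lexx => /(_ isT).
  by have := sqr_ge0 (1 - x); lra.
have p2 : 0 < modc (1 - t * x%:C).
  rewrite modc_gt0 one_sub_neq0 // modcM modc_real ger0_norm //.
  by apply: le_lt_trans t1; rewrite ler_piMr ?modc_ge0.
rewrite /moebius !mulr1 !modcf modcM modcN modc_real ger0_norm //.
rewrite ler_pdivrMr // mulrAC ler_pdivlMr // -mulrA ler_wpM2l ?modc_ge0 //.
Qed.

Lemma moebius_dist t x : modc t < 1 -> 0 <= x <= 1 ->
  modc (moebius t x%:C - moebius t 1) <=
    (1 - x) * (modc t / (modc (1 - t) * (1 - modc t))).
Proof.
move=> t1 /andP[x0 x1].
have tx : modc (t * x%:C) <= modc t.
  by rewrite modcM modc_real ger0_norm // ler_piMr ?modc_ge0.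
have n1 := one_sub_neq0 t1; have n2 := one_sub_neq0 (le_lt_trans tx t1).
have -> : moebius t x%:C - moebius t 1 =
    (1 - x)%:C * (t / ((1 - t) * (1 - t * x%:C))).
  by rewrite /moebius mulr1 rmorphB /=; field; rewrite n1 n2.
rewrite modcM modc_real ger0_norm ?subr_ge0 // ler_wpM2l ?subr_ge0 //.
rewrite modcf ler_wpM2l ?modc_ge0 // modcM lef_pV2 ?posrE.
- rewrite ler_wpM2l ?modc_ge0 //.
  by have := modc_subr_ge 1 (t * x%:C); rewrite modc1; lra.
- by rewrite mulr_gt0 ?modc_gt0.
- by rewrite mulr_gt0 ?modc_gt0 ?subr_gt0.
Qed.

Section Core.
Variables (l t : R[i]) (e A : nat -> R[i]) (p : nat) (B : R).
Hypotheses (t1 : modc t < 1) (p0 : (0 < p)%N).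
Hypothesis eB : boundedSums (fun n => modc (e n) * modc (moebius t 1) ^+ n) B.

(** The coefficient of z^N in the sum over n of
    e_n (- t z)^n (1 - t z)^(- l - n). *)
Definition euler_coef N : R[i] :=
  \sum_(n < N.+1) e n * (- t) ^+ n * (binc (l + n%:R) (N - n)%N * t ^+ (N - n)).

(** The coefficient of z^n in A(z^p) times the series of the [euler_coef]. *)
Definition lacunary_coef n : R[i] :=
  \sum_(j < (n %/ p).+1) A j * euler_coef (n - p * j)%N.

Definition closed_form z : R[i] :=
  pser A (z ^+ p) * (binser l (t * z) * pser e (moebius t z)).

(** For |z| <= 1/3 one has |t z| / (1 - |t z|) <= |w(1)|, which makes the double
    series in powers of t z absolutely convergent; summed by rows it gives the
    closed form, summed by antidiagonals the power series in z. *)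
Lemma euler_series z : modc z <= 1 / 3 ->
  hasSum (fun N => euler_coef N * z ^+ N)
    (binser l (t * z) * pser e (moebius t z)) /\
  exists M, boundedSums (fun N => modc (euler_coef N * z ^+ N)) M.
Proof.
move=> z3; set u := t * z; set w := moebius t z.
have q0 := modc_ge0 u; set q := modc u in q0.
have qz : q <= modc z by rewrite /q modcM ler_piMl ?modc_ge0 // ltW.
have q1 : q < 1 by lra.
have p1 : 0 < modc (1 - t) by rewrite modc_gt0 one_sub_neq0.
have qw : q / (1 - q) <= modc (moebius t 1).
  rewrite /moebius !mulr1 modcf modcN.
  rewrite ler_pdivrMr ?subr_gt0 // mulrAC ler_pdivlMr //.
  have h : modc z * modc (1 - t) <= 1 - q.
    by have := ler_wpM2l (modc_ge0 z) (modc_one_sub_le2 t1); lra.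
  by rewrite {1}/q modcM -mulrA ler_wpM2l ?modc_ge0.
have ww : modc w <= modc (moebius t 1).
  apply: le_trans qw; rewrite /w /moebius modcf mulNr modcN -/u -/q.
  rewrite ler_wpM2l // lef_pV2 ?posrE ?modc_gt0 ?one_sub_neq0 ?subr_gt0 //.
  by have := modc_subr_ge 1 u; rewrite modc1.
have [M hM] := binc_bounded l q0 q1.
have M0 := boundedSums_ge0 hM.
pose f n j := e n * (- u) ^+ n * (binc (l + n%:R) j * u ^+ j).
have fB : boundedSums (fun x : nat * nat => modc (f x.1 x.2)) (M * B).
  apply: (@boundedSums_rows _ _ _ (fun n j => modc (f n j))
    (fun n => M * (modc (e n) * modc (moebius t 1) ^+ n))).
  - by move=> n j; apply: modc_ge0.
  - move=> n; have eq0 : 0 <= modc (e n) * q ^+ n by rewrite mulr_ge0 ?modc_ge0 ?exprn_ge0.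
    have := boundedSumsZ eq0 (binc_bounded_addn n q0 q1 hM).
    move/(boundedSumsW (N := M * (modc (e n) * modc (moebius t 1) ^+ n))) => h.
    apply: boundedSums_le (h _) => [j|].
      by rewrite /f modcM [X in X * _ <= _]modcM [X in _ * X <= _]modcM !modcX modcN.
    rewrite [leLHS](_ : _ = M * (modc (e n) * (q / (1 - q)) ^+ n)); last first.
      by rewrite exprMn; ring.
    rewrite ler_wpM2l // ler_wpM2l ?modc_ge0 //.
    by rewrite lerXn2r ?nnegrE ?modc_ge0 ?divr_ge0 // subr_ge0 ltW.
  - exact: boundedSumsZ.
have hf : hasSum (fun x : nat * nat => f x.1 x.2) (binser l u * pser e w).
  have h := csumP fB; set v := csum _ in h.
  suff <- : v = binser l u * pser e w by [].
  have hw := hasSumZ (binser l u) (pserP eB ww).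
  apply: hasSum_unique hw; apply: hasSum_rows h => n.
  have -> : binser l u * (e n * w ^+ n) = e n * (- u) ^+ n * binser (l + n%:R) u.
    by rewrite binser_addn // /w /moebius exprMn mulNr -/u; ring.
  by apply: hasSumZ; apply: binserP.
have [h1 h2] := hasSum_packets (ltn0Sn 0) fB hf.
have E N : \sum_(n < (N %/ 1).+1) f n (N - 1 * n)%N = euler_coef N * z ^+ N.
  rewrite divn1 mulr_suml; apply: eq_bigr => n _.
  have nN : (n <= N)%N by rewrite -ltnS.
  have -> : z ^+ N = z ^+ n * z ^+ (N - n) by rewrite -exprD subnKC.
  rewrite /f mul1n /u -mulNr !exprMn; ring.
split; first by apply: eq_hasSum h1 => N; rewrite -E.
by exists (M * B); apply: boundedSums_le h2 => N; rewrite -E.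
Qed.

Lemma lacunary_series MA z : (forall n, modc (A n) <= MA) -> modc z <= 1 / 3 ->
  pser lacunary_coef z = closed_form z.
Proof.
move=> AM z3; apply: hasSum_csum.
have [h [M hM]] := euler_series z3.
have zp : modc (z ^+ p) <= 1 / 3.
  have z1 : modc z <= 1 by lra.
  by rewrite modcX; apply: le_trans z3; rewrite -[leRHS]expr1 ler_wiXn2l ?modc_ge0.
have z0 : 0 <= 1 / 3 :> R by lra.
have z1 : 1 / 3 < 1 :> R by lra.
have bA := bounded_coef_pser z0 z1 AM.
have hA := pserP bA zp.
have bA' : boundedSums (fun n => modc (A n * (z ^+ p) ^+ n)) (MA * (1 - 1 / 3)^-1).
  apply: boundedSums_le bA => n; rewrite modcM [X in _ * X <= _]modcX.
  by rewrite ler_wpM2l ?modc_ge0 // lerXn2r ?nnegrE ?modc_ge0.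
have [h1 _] := hasSum_convolution p0 bA' hM hA h.
apply: eq_hasSum h1 => n; rewrite /lacunary_coef mulr_suml; apply: eq_bigr => j _.
have jn : (p * j <= n)%N by rewrite mulnC -leq_divRL // -ltnS.
by rewrite mulrACA -exprM -exprD subnKC // -mulrA.
Qed.

(** The radius d = (1 - x)^2 / 12 works at all points of [0, x]: the discs
    stay inside the unit disc, and by [moebius_gap] the Wiener norm of the
    Moebius map on them is at most |w(1)|, the radius up to which G is known to
    converge. *)
Lemma lacunary_series_unit_interval MA Mc x :
  (forall n, modc (A n) <= MA) -> (forall n, modc (lacunary_coef n) <= Mc) ->
  0 <= x < 1 -> pser lacunary_coef x%:C = closed_form x%:C.
Proof.
move=> AM cM /andP[x0 x1].
pose H z := pser lacunary_coef z - closed_form z.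
suff : H x%:C = 0 by move/eqP; rewrite subr_eq0 => /eqP.
pose d := (1 - x) ^+ 2 / 12.
have px : 0 < 1 - x by lra.
have d0 : 0 < d by rewrite divr_gt0 // exprn_gt0.
have dx : d <= (1 - x) / 2 by rewrite /d; nra.
have z3 : 0 < 1 / 3 :> R by lra.
apply: (taylor_continuation (s := x) d0 z3); last by rewrite x0 lexx.
  move=> y /andP[y0 yx]; pose r := (1 + x) / 2.
  have r0 : 0 <= r by rewrite /r; lra.
  have r1 : r < 1 by rewrite /r; lra.
  have ny : modc (y%:C : R[i]) = y by rewrite modc_real ger0_norm.
  have yr : y + d <= r by rewrite /r; lra.
  have yd0 : 0 <= y + d by rewrite addr_ge0 // ltW.
  have d0' := ltW d0.
  have T0 := taylorOn_id (y%:C : R[i]) d0'; rewrite ny in T0.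
  have T1 := taylorOn_pser d0 T0 yr (bounded_coef_pser r0 r1 cM).
  have ydp : (y + d) ^+ p <= r.
    have yd1 := le_trans yr (ltW r1).
    by apply: le_trans (_ : y + d <= _) => //; rewrite -[leRHS]expr1 ler_wiXn2l.
  have T2 := taylorOn_pser d0 (taylorOnX p d0' T0) ydp (bounded_coef_pser r0 r1 AM).
  have T3 := taylorOnM d0' (taylorOn_cst y%:C d t) T0.
  have tyr : modc t * (y + d) <= r.
    by apply: le_trans (_ : y + d <= _) => //; rewrite ler_piMl // ltW.
  have [Mb hMb] := binc_bounded l r0 r1.
  have T4 := taylorOn_pser d0 T3 tyr hMb.
  have T5 := taylorOnM d0' (taylorOn_cst y%:C d (- t)) T0.
  have gap := @moebius_gap t y x t1 _ x1; rewrite y0 yx in gap.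
  have {}gap := gap isT.
  have p1 : 0 < modc (1 - t) by rewrite modc_gt0 one_sub_neq0.
  have t2 := modc_one_sub_le2 t1.
  have gap2 : (y + d) * modc (1 - t) <= modc (1 - t * y%:C) - modc t * d.
    have dE : (1 - x) ^+ 2 / 4 = 3 * d by rewrite /d; field.
    rewrite dE in gap.
    have := ler_wpM2l d0' t2; have := ler_wpM2l d0' (ltW t1); lra.
  have ydp1 : 0 < (y + d) * modc (1 - t) by rewrite mulr_gt0 //; lra.
  have gap3 : modc t * d < modc (1 - t * y%:C) by lra.
  have T6 := taylorOnM d0' T5 (taylorOn_inv d0' gap3).
  have wr : modc (- t) * (y + d) * (modc (1 - t * y%:C) - modc t * d)^-1 <=
      modc (moebius t 1).
    rewrite /moebius !mulr1 modcf modcN.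
    rewrite ler_pdivrMr ?subr_gt0 // mulrAC ler_pdivlMr //.
    by rewrite -mulrA ler_wpM2l ?modc_ge0.
  have T7 := taylorOn_pser d0 T6 wr eB.
  by eexists; apply: taylorOnB T1 (taylorOnM d0' T2 (taylorOnM d0' T4 T7)).
by move=> h h3; rewrite /H (lacunary_series AM h3) subrr.
Qed.

Theorem lacunary_sum v a :
  series (lacunary_coef : nat -> R[i]^o) @ \oo --> (v : R[i]^o) ->
  series (A : nat -> R[i]^o) @ \oo --> (a : R[i]^o) ->
  v = a * (cpow (1 - t) (- l) * pser e (moebius t 1)).
Proof.
move=> hv ha.
have [MA AM] := series_coef_bounded ha; have [Mc cM] := series_coef_bounded hv.
have lim1 : (closed_form s%:C : R[i]^o) @[s --> 1^'-] --> (v : R[i]^o).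
  apply: cvg_left1 => eps eps0; have [d d0 hd] := abel_limit hv eps0.
  exists d => // s s0 s1 sd.
  rewrite -(lacunary_series_unit_interval AM cM); first exact: hd.
  by rewrite s0 s1.
have limA : (pser A (s%:C ^+ p) : R[i]^o) @[s --> 1^'-] --> (a : R[i]^o).
  apply: cvg_left1 => eps eps0; have [d d0 hd] := abel_limit ha eps0.
  have pr : 0 < (p%:R : R) by rewrite ltr0n.
  exists (d / p%:R) => [|s s0 s1 sd]; first by rewrite divr_gt0.
  rewrite -rmorphXn; apply: hd.
  - by rewrite exprn_ge0.
  - by rewrite exprn_ilt1 // -lt0n.
  - have bern n : 1 - n%:R * (1 - s) <= s ^+ n.
      elim: n => [|n IH]; first by rewrite mul0r subr0.
      have sn : s ^+ n <= 1 by rewrite exprn_ile1 // ltW.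
      rewrite exprS -natr1; nra.
    apply: lt_le_trans (bern p).
    have : 1 - s < d / p%:R by lra.
    by rewrite ltr_pdivlMr // mulrC; lra.
have limB : (binser l (t * s%:C) : R[i]^o) @[s --> 1^'-] --> (binser l t : R[i]^o).
  apply: cvg_left1 => eps eps0.
  have [M hM] := binc_bounded l (modc_ge0 t) t1.
  have [d d0 hd] := pser_continuous (lexx (modc t)) hM eps0.
  exists d => // s s0 s1 sd; apply: hd.
    by rewrite modcM modc_real ger0_norm // ler_piMr ?modc_ge0 // ltW.
  have -> : t * s%:C - t = t * (s - 1)%:C by rewrite rmorphB /=; ring.
  rewrite modcM modc_real ltr0_norm ?opprB; last by lra.
  have ps : 0 <= 1 - s by lra.
  by apply: le_lt_trans (ler_piMl ps (ltW t1)) _; lra.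
have limG : (pser e (moebius t s%:C) : R[i]^o) @[s --> 1^'-] -->
    (pser e (moebius t 1) : R[i]^o).
  apply: cvg_left1 => eps eps0.
  have [d d0 hd] := pser_continuous (lexx (modc (moebius t 1))) eB eps0.
  pose K := modc t / (modc (1 - t) * (1 - modc t)).
  have K0 : 0 <= K by rewrite divr_ge0 ?mulr_ge0 ?modc_ge0 // subr_ge0 ltW.
  exists (d / (K + 1)) => [|s s0 s1 sd]; first by rewrite divr_gt0 //; lra.
  have s01 : 0 <= s <= 1 by rewrite s0 ltW.
  apply: hd; first exact: moebius_le.
  apply: le_lt_trans (moebius_dist t1 s01) _; rewrite -/K.
  have : 1 - s < d / (K + 1) by lra.
  rewrite ltr_pdivlMr; last by lra.
  by apply: le_lt_trans; rewrite ler_wpM2l; lra.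
rewrite -binser_cpow //.
by apply: (norm_cvg_unique lim1); apply: cvgM limA (cvgM limB limG).
Qed.

End Core.
End Continuation.

(** * Collecting the multiple series, and the generating function *)

Section Hypergeometric.
Variable R : realType.
Implicit Types (z l t : R[i]).

Lemma poch_nat (l : R[i]) n : poch l (n%:R : R) = pochn l n.
Proof. by rewrite /poch natr_nat natrK. Qed.

Lemma pochn_opp_fact N d : (d <= N)%N ->
  pochn (- N%:R : R[i]) d * (N - d)`!%:R = (- 1) ^+ d * N`!%:R.
Proof.
elim: d => [|d IH] dN; first by rewrite pochn0 subn0 expr0.
rewrite exprS -mulrA -IH ?(ltnW dN) // pochnS.
have -> : (N - d)%N = (N - d.+1).+1 by rewrite subnSK.
have -> : - N%:R + d%:R = - (N - d.+1).+1%:R :> R[i].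
  by rewrite subnSK // natrB ?(ltnW dN) // opprB addrC.
rewrite factS natrM; ring.
Qed.

Lemma pochn_opp_eq0 N d : (N < d)%N -> pochn (- N%:R : R[i]) d = 0.
Proof.
move=> Nd; rewrite -(subnKC Nd) pochnD pochnS addrC subrr.
by rewrite mulr0 mul0r.
Qed.

Lemma pochn_opp_neq0 N : pochn (- N%:R : R[i]) N != 0.
Proof.
have := pochn_opp_fact (leqnn N); rewrite subnn fact0 mulr1 => ->.
by rewrite mulf_neq0 ?signr_eq0 // natC_neq0 // fact_gt0.
Qed.

(** Terms that depend on the multi-index only through idx, apart from a fixed factor,
    are collected into a simple series; unconditional convergence allows it. *)
Lemma group_by_index (T : choiceType) (idx : T -> nat) (q : T -> R[i])
    (c : nat -> R[i]) (Q : nat -> R[i]) (v : R[i]) :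
  (forall d, hasSum (fun m => if idx m == d then q m else 0) (Q d)) ->
  hasSum (fun m => c (idx m) * q m) v ->
  hasSum (fun d => c d * Q d) v /\
  exists M, boundedSums (fun d => modc (c d * Q d)) M.
Proof.
move=> hQ hv; have [M hM] := hasSum_bounded hv.
have [h1 h2] := csum_fibers idx hM; rewrite (hasSum_csum hv) in h1.
have E d : csum (fun m => if idx m == d then c (idx m) * q m else 0) = c d * Q d.
  apply: hasSum_csum; apply: eq_hasSum (hasSumZ (c d) (hQ d)) => m.
  by case: eqP => [->|]; rewrite ?mulr0.
split; first by apply: eq_hasSum h1 => d; rewrite E.
by exists M; apply: boundedSums_le h2 => d; rewrite E.
Qed.

Variables (r k : nat) (be ga x : 'I_r -> R[i]).
Implicit Type m : {ffun 'I_r -> nat}.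

Definition multi_index (N : nat) m : nat :=
  (N * (\sum_(i < r | (i < k)%N) m i) + \sum_(i < r | (k <= i)%N) m i)%N.

Definition monomial_coef m : R[i] :=
  ((\prod_(i < r | (k <= i)%N) pochn (be i) (m i))
     / (\prod_(i < r) pochn (ga i) (m i)))
  * \prod_(i < r) (x i ^+ m i / (m i)`!%:R).

(** A natural value N of rho makes every Pochhammer index natural.  It constrains rho
    only if the first group of variables is nonempty, which is when rho enters
    the index. *)
Definition natural_order (rho : R) N := forall i : 'I_r, (i < k)%N -> rho = N%:R.

Lemma E_index_nat rho N m : natural_order rho N ->
  E_index rho k m = (multi_index N m)%:R.
Proof.
move=> h; rewrite /E_index /multi_index natrD natrM; congr (_ + _).
case: (pickP (fun i : 'I_r => (i < k)%N)) => [i ik|no]; first by rewrite (h i).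
by rewrite big_pred0 // !mulr0.
Qed.

Lemma E_term_nat rho N al m : natural_order rho N ->
  E_term rho k al be ga x m = pochn al (multi_index N m) * monomial_coef m.
Proof. by move=> h; rewrite /E_term (E_index_nat _ h) poch_nat -mulrA. Qed.

(** For natural rho the arguments in both groups are powers of w(1) times
    those of x, and the powers multiply to the Pochhammer index. *)
Lemma E_term_arg rho N al t m : natural_order rho N -> modc t < 1 -> t != 0 ->
  E_term rho k al be ga (E_arg rho k t x) m =
  pochn al (multi_index N m) * moebius t 1 ^+ (multi_index N m) * monomial_coef m.
Proof.
move=> h t1 t0; set w := moebius t 1.
rewrite /E_term (E_index_nat _ h) poch_nat /monomial_coef.
have nt := one_sub_neq0 t1.
have wE : w = - t / (1 - t) by rewrite /w /moebius !mulr1.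
have argE i : E_arg rho k t x i = x i * w ^+ (if (i < k)%N then N else 1)%N.
  rewrite /E_arg; case: ifP => ik; last by rewrite expr1 wE; ring.
  by rewrite (h i ik) !cpow_nat ?oppr_eq0 // -mulrA -expr_div_n -wE.
have -> : \prod_(i < r) (E_arg rho k t x i ^+ m i / (m i)`!%:R) =
    w ^+ multi_index N m * \prod_(i < r) (x i ^+ m i / (m i)`!%:R).
  have -> : multi_index N m = (\sum_(i < r) (if (i < k)%N then N else 1) * m i)%N.
    rewrite /multi_index [RHS](bigID (fun i : 'I_r => (i < k)%N)) /=; congr addn.
      by rewrite big_distrr; apply: eq_bigr => i ->.
    apply: eq_big => i; first by rewrite -leqNgt.
    by rewrite leqNgt => /negPf ->; rewrite mul1n.
  rewrite expr_sum -big_split /=; apply: eq_bigr => i _.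
  by rewrite argE exprMn -exprM mulrCA mulrA.
ring.
Qed.

Lemma E_hasSum rho al (X : 'I_r -> R[i]) : E_exists rho k al be ga X ->
  hasSum (E_term rho k al be ga X) (E rho k al be ga X).
Proof. by case=> _ _ _ h; split. Qed.

(** The symbol (- n)_nu is defined only for natural nu; the multi-index with
    a single 1 in the first group has nu = rho. *)
Lemma natural_order_exists rho n :
  E_exists rho k (- n%:R) be ga x -> exists N, natural_order rho N.
Proof.
case=> _ hp _ _.
case: (pickP (fun i : 'I_r => (i < k)%N)) => [i ik|no]; last first.
  by exists 0%N => i; rewrite no.
have := hp [ffun j => (j == i) : nat].
have -> : E_index rho k [ffun j => (j == i) : nat] = rho.
  rewrite /E_index (bigD1 i) //= ffunE eqxx big1 ?addn0 => [|j /andP[_ ji]].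
    rewrite big1 ?addr0 ?mulr1 // => j kj; rewrite ffunE.
    by case: eqP kj => // ->; rewrite leqNgt ik.
  by rewrite ffunE (negPf ji).
by case=> [/natrP[N ->]|[[]]]; [exists N|exists n].
Qed.

(** The packet of index d is summable because (- d)_d does not vanish, so that
    it can be read off the series with parameter - d, whose existence is assumed. *)
Lemma packet_exists rho N d : natural_order rho N ->
  E_exists rho k (- d%:R) be ga x ->
  exists Q, hasSum (fun m => if multi_index N m == d then monomial_coef m else 0) Q.
Proof.
move=> h /E_hasSum/hasSum_bounded[M hM].
have p := pochn_opp_neq0 d; set c := pochn _ d in p.
have cm : 0 < modc c by rewrite modc_gt0.
have b : boundedSums (fun m => modc (if multi_index N m == d
    then monomial_coef m else 0)) ((modc c)^-1 * M).
  have c0 : 0 <= (modc c)^-1 by rewrite invr_ge0 modc_ge0.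
  apply: boundedSums_le (boundedSumsZ c0 hM) => m.
  rewrite (E_term_nat _ _ h); case: eqP => [->|_].
    by rewrite modcM mulrA mulVf ?mul1r // gt_eqF.
  by rewrite modc0 mulr_ge0 ?modc_ge0.
by exists (csum (fun m => if multi_index N m == d then monomial_coef m else 0));
  exact: csumP b.
Qed.

Lemma terminating_E (Q : nat -> R[i]) rho N n : natural_order rho N ->
  (forall d, hasSum (fun m => if multi_index N m == d then monomial_coef m else 0) (Q d)) ->
  E_exists rho k (- n%:R) be ga x ->
  E rho k (- n%:R) be ga x = \sum_(d < n.+1) pochn (- n%:R) d * Q d.
Proof.
move=> h hQ /E_hasSum he.
have he' : hasSum (fun m => pochn (- n%:R) (multi_index N m) * monomial_coef m)
    (E rho k (- n%:R) be ga x).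
  by apply: eq_hasSum he => m; rewrite (E_term_nat _ _ h).
have [hs _] := group_by_index hQ he'.
apply: hasSum_unique hs _.
apply: (@hasSum_reindex _ 'I_n.+1 _ (fun d => d : nat) (fun d => inord d)).
- by move=> d; rewrite inord_val.
- move=> d; case: (ltnP d n.+1) => nd; first by rewrite inordK ?eqxx.
  by rewrite pochn_opp_eq0 // mul0r.
- exact: hasSum_ord.
Qed.

Lemma euler_coef_E (Q : nat -> R[i]) rho N l t n : natural_order rho N ->
  (forall d, hasSum (fun m => if multi_index N m == d then monomial_coef m else 0) (Q d)) ->
  E_exists rho k (- n%:R) be ga x ->
  pochn l n * E rho k (- n%:R) be ga x / n`!%:R * t ^+ n =
  euler_coef l t (fun d => pochn l d * Q d) n.
Proof.
move=> h hQ he; rewrite (terminating_E h hQ he) /euler_coef mulr_sumr !mulr_suml.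
apply: eq_bigr => d _; have dn : (d <= n)%N by rewrite -ltnS.
have f1 := natC_neq0 R (fact_gt0 n).
have f2 := natC_neq0 R (fact_gt0 (n - d)).
have e1 : pochn (- n%:R) d / n`!%:R = (- 1) ^+ d / (n - d)`!%:R :> R[i].
  apply: (mulIf f1); rewrite divfK // mulrAC; apply: (mulIf f2).
  by rewrite divfK // pochn_opp_fact.
have -> : pochn l n * (pochn (- n%:R) d * Q d) / n`!%:R * t ^+ n =
  pochn l n * Q d * t ^+ n * (pochn (- n%:R) d / n`!%:R) by ring.
rewrite e1 /binc -{1}(subnKC dn) pochnD.
have -> : t ^+ n = t ^+ d * t ^+ (n - d) by rewrite -exprD subnKC.
by rewrite (exprNn t); ring.
Qed.

End Hypergeometric.

Theorem theorem7 (R : realType) (r k s p : nat) (rho : R)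
    (lambda mu psi eta t : R[i]) (be ga x : 'I_r -> R[i])
    (y : 'I_s -> R[i]) (Omega : R[i] -> ('I_s -> R[i]) -> R[i])
    (a : nat -> R[i]) :
  (1 <= r)%N -> (k <= r)%N -> (1 <= s)%N -> (1 <= p)%N -> 0 <= rho ->
  `|t| < 1 ->
  (forall nu : R[i], exists w : 'I_s -> R[i], Omega nu w != 0) ->
  (forall l : nat, a l != 0) ->
  (* the left-hand member exists *)
  t != 0 ->
  (forall n : nat, Theta_exists rho k be ga x n p) ->
  cvgn (series (fun n : nat =>
    (Theta rho k lambda be ga a Omega mu psi n p x y (eta / t ^+ p) * t ^+ n)
      : R[i]^o)) ->
  (* the right-hand member exists *)
  Lambda_exists a Omega mu psi y eta ->
  E_exists rho k lambda be ga (E_arg rho k t x) ->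
  limn (series (fun n : nat =>
    (Theta rho k lambda be ga a Omega mu psi n p x y (eta / t ^+ p) * t ^+ n)
      : R[i]^o))
  = Lambda a Omega mu psi y eta * cpow (1 - t) (- lambda)
    * E rho k lambda be ga (E_arg rho k t x).
Proof.
move=> _ _ _ p0 _ t1 _ _ t0 hTheta cvT cvL hE.
have {}t1 : modc t < 1 by move: t1; rewrite norm_modc ltcR.
have hEn n : E_exists rho k (- n%:R) be ga x.
  by have := hTheta n 0%N (leq0n _); rewrite muln0 subn0.
have [N hN] := natural_order_exists (hEn 0%N).
have [Q hQ] := choice (fun d => packet_exists hN (hEn d)).
pose e d := pochn lambda d * Q d.
pose A l : R[i] := Lambda_term a Omega mu psi y eta l.
have hEarg : hasSum (fun d => pochn lambda d * moebius t 1 ^+ d * Q d)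
      (E rho k lambda be ga (E_arg rho k t x)) /\
    exists M, boundedSums (fun d => modc (pochn lambda d * moebius t 1 ^+ d * Q d)) M.
  apply: (group_by_index (c := fun d => pochn lambda d * moebius t 1 ^+ d) hQ).
  apply: eq_hasSum (E_hasSum hE) => m.
  exact: E_term_arg hN t1 t0.
have [hs [B hB]] := hEarg.
have eB : boundedSums (fun n => modc (e n) * modc (moebius t 1) ^+ n) B.
  apply: boundedSums_le hB => n.
  by rewrite [X in _ <= modc X]mulrAC (modcM (e n)) modcX.
have EE : E rho k lambda be ga (E_arg rho k t x) = pser e (moebius t 1).
  apply: hasSum_unique hs _; apply: eq_hasSum (pserP eB (lexx _)) => d.
  by rewrite /e mulrAC.
have termE n : Theta rho k lambda be ga a Omega mu psi n p x y (eta / t ^+ p) * t ^+ n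
    = lacunary_coef lambda t e A p n.
  rewrite /Theta /lacunary_coef mulr_suml; apply: eq_bigr => j _.
  have jn : (p * j <= n)%N by rewrite mulnC -leq_divRL // -ltnS.
  rewrite -(euler_coef_E lambda t hN hQ (hEn _)) /A /Lambda_term.
  have -> : t ^+ n = (t ^+ p) ^+ j * t ^+ (n - p * j) by rewrite -exprM -exprD subnKC.
  have tp : (t ^+ p) ^+ j != 0 by rewrite !expf_neq0.
  rewrite expr_div_n; field.
  by rewrite tp natC_neq0 // fact_gt0.
move: cvT; under eq_fun do rewrite termE; move=> cvT.
by rewrite (lacunary_sum t1 p0 eB cvT cvL) EE mulrA.
Qed.
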